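(* Let $n\ge 1$, let $(V,\eta)$ be a Minkowski space of dimension $n+2$ (signature $(1,n+1)$), and let $p\in V$ be a nonzero isotropic vector. Let $G$ be a proper connected Lie subgroup (not necessarily closed) of $SO(V)_{\mathbb{R}p}$. Then $G$ acts weakly-irreducibly on $V$ if and only if $G$ acts transitively on the set $\partial L^{n+1}\setminus\{\mathbb{R}p\}$ of all isotropic lines of $V$ different from $\mathbb{R}p$ (which is identified with the Euclidean space $E$).
   Context: $(V,\eta)$ is a real vector space of dimension $n+2$ with a nondegenerate symmetric bilinear form $\eta$ of signature $(1,n+1)$ (one minus sign, $n+1$ plus signs). Fix a basis $p,e_1,\dots,e_n,q$ of $V$ in which $\eta(p,p)=\eta(q,q)=0$, $\eta(p,q)=1$, $\eta(e_i,e_j)=\delta_{ij}$, $\eta(p,e_i)=\eta(q,e_i)=0$. Put $E=\mathrm{span}\{e_1,\dots,e_n\}$, a Euclidean space with inner product $\eta|_E$. $SO(V)$ is the Lie group of linear automorphisms of $V$ preserving $\eta$ and having determinant $1$; $SO(V)_{\mathbb{R}p}$ is the Lie subgroup of elements preserving the isotropic line $\mathbb{R}p$. A subgroup $G\subset SO(V)$ is (acts) weakly-irreducible(ly) if it preserves no nondegenerate proper subspace of $V$, i.e. no linear subspace $U$ with $\{0\}\ne U\ne V$ such that $\eta|_U$ is nondegenerate. $\partial L^{n+1}$ is the set of all isotropic lines in $V$ (the boundary of the Lobachevskian space), viewed as a subset of the projective space of $V$; it is diffeomorphic to the sphere $S^n$. $SO(V)_{\mathbb{R}p}$ acts naturally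 on $\partial L^{n+1}\setminus\{\mathbb{R}p\}$. By stereographic projection from $\mathbb{R}p$ this set is identified with $E$; up to a constant homothety of $E$, the identification sends $Y\in E$ to the line $\mathbb{R}\left(-\tfrac12\eta(Y,Y)p+Y+q\right)$. Under this identification elements of $SO(V)_{\mathbb{R}p}$ act on $E$ by similarity transformations. *)

(* Defs.v *)
From HB Require Import structures.
From mathcomp Require Import all_boot all_order all_algebra.
From mathcomp Require Import all_classical all_reals all_analysis.

Set Implicit Arguments.
Unset Strict Implicit.
Unset Printing Implicit Defensive.

Import Order.TTheory GRing.Theory Num.Theory.
Import numFieldNormedType.Exports.

Local Open Scope classical_set_scope.
Local Open Scope ring_scope.

(* C^m maps on an open subset A of a finite-dimensional space, by iterated
   directional derivatives; the values of f outside A are irrelevant. *)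
Fixpoint Cn_on (R : realType) (U W : normedModType R) (m : nat)
    (A : set U) (f : U -> W) : Prop :=
  match m with
  | 0%N => {in A, continuous f}
  | m'.+1 => {in A, forall x, differentiable f x} /\
             forall v : U, Cn_on m' A ('D_v f)
  end.

Definition smooth_on (R : realType) (U W : normedModType R)
    (A : set U) (f : U -> W) : Prop :=
  forall m : nat, Cn_on m A f.

(* chart_map and chart_inv are total functions, meaningful only on chart_dom
   and chart_img, between which they are mutually inverse homeomorphisms. *)
Record chart (R : realType) (k : nat) (T : topologicalType) := Chart {
  chart_dom : set T;
  chart_img : set 'rV[R]_k;
  chart_map : T -> 'rV[R]_k;
  chart_inv : 'rV[R]_k -> T;
  chart_dom_open : open chart_dom;
  chart_img_open : open chart_img;
  chart_map_fun : set_fun chart_dom chart_img chart_map;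
  chart_inv_fun : set_fun chart_img chart_dom chart_inv;
  chart_mapK : {in chart_dom, cancel chart_map chart_inv};
  chart_invK : {in chart_img, cancel chart_inv chart_map};
  chart_map_continuous : {in chart_dom, continuous chart_map};
  chart_inv_continuous : {in chart_img, continuous chart_inv}
}.

(* No compatibility between the topology and the group law is built in here;
   it is required in is_lie_group. *)
#[short(type="groupTopologicalType")]
HB.structure Definition GroupTopological :=
  {H of Topological H & Group H}.

Record is_lie_group (R : realType) (k : nat) (H : groupTopologicalType)
    (atlas : set (chart R k H)) : Prop := IsLieGroup {
  lie_hausdorff : hausdorff_space H;
  lie_second_countable : @second_countable H;
  lie_atlas_cover : forall x : H, exists2 c, atlas c & chart_dom c x;
  lie_atlas_smooth : forall a b, atlas a -> atlas b ->
    smooth_on [set w | chart_img a w /\ chart_dom b (chart_inv a w)]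
      (fun w => chart_map b (chart_inv a w));
  lie_mul_continuous : continuous (fun z : H * H => (z.1 * z.2)%g);
  lie_mul_smooth : forall a b c, atlas a -> atlas b -> atlas c ->
    smooth_on
      [set z : 'rV[R]_k * 'rV[R]_k |
        [/\ chart_img a z.1, chart_img b z.2 &
            chart_dom c (chart_inv a z.1 * chart_inv b z.2)%g]]
      (fun z => chart_map c (chart_inv a z.1 * chart_inv b z.2)%g);
  lie_inv_continuous : continuous (fun x : H => (x^-1)%g);
  lie_inv_smooth : forall a b, atlas a -> atlas b ->
    smooth_on [set w | chart_img a w /\ chart_dom b (chart_inv a w)^-1%g]
      (fun w => chart_map b (chart_inv a w)^-1%g)
}.

Definition matrix_of (R : realType) (V : vectType R) (g : 'End(V)) :
    'M[R]_(\dim {:V}) :=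
  passmx.mxof (vbasis {:V}) (vbasis {:V}) g.

(* 'End(V) carries no topology in the library, hence the coordinates. *)
Definition smooth_immersion (R : realType) (V : vectType R) (k : nat)
    (H : topologicalType) (atlas : set (chart R k H)) (f : H -> 'End(V)) :
    Prop :=
  forall c, atlas c ->
    let F : 'rV[R]_k -> 'M[R]_(\dim {:V}) :=
      fun w => matrix_of (f (chart_inv c w)) in
    smooth_on (chart_img c) F /\ {in chart_img c, forall w, injective ('d F w)}.

(* G is the image of a connected Lie group under an injective immersive
   homomorphism. The topology of H may be strictly finer than the one induced
   by 'End(V), so G need not be closed. For G contained in a closed subgroup S
   of GL(V), an immersion into S is the same thing as an immersion into 'End(V)
   with values in S, because S is an embedded submanifold. *)
Definition connected_lie_subgroup (R : realType) (V : vectType R)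
    (G : set 'End(V)) : Prop :=
  exists (k : nat) (H : groupTopologicalType) (atlas : set (chart R k H))
      (f : H -> 'End(V)),
    [/\ is_lie_group atlas,
        connected [set: H],
        f 1%g = \1%VF /\ (forall x y : H, f (x * y)%g = (f x \o f y)%VF),
        injective f /\ range f = G &
        smooth_immersion atlas f].

(* r minus signs and s plus signs; in particular V has dimension r + s and eta
   is nondegenerate. *)
Definition has_signature (R : realType) (V : vectType R) (eta : {symmetric V})
    (r s : nat) : Prop :=
  exists2 b : (r + s).-tuple V, basis_of {:V} b &
    forall i j : 'I_(r + s),
      eta b`_i b`_j = if i == j then (if (i < r)%N then -1 else 1) else 0.

Definition SO (R : realType) (V : vectType R) (eta : {symmetric V}) :
    set 'End(V) :=
  [set g : 'End(V) | (forall u v, eta (g u) (g v) = eta u v) /\ \det (matrix_of g) = 1].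

Definition SO_line (R : realType) (V : vectType R) (eta : {symmetric V})
    (p : V) : set 'End(V) :=
  [set g : 'End(V) | SO eta g /\ (g @: <[p]>)%VS = <[p]>%VS].

Definition nondegenerate_on (R : realType) (V : vectType R)
    (eta : {symmetric V}) (U : {vspace V}) : Prop :=
  {in U, forall u, {in U, forall v, eta u v = 0} -> u = 0}.

Definition weakly_irreducible (R : realType) (V : vectType R)
    (eta : {symmetric V}) (G : set 'End(V)) : Prop :=
  ~ exists U : {vspace V},
      [/\ U != 0%VS, U != fullv, nondegenerate_on eta U &
          forall g, G g -> (g @: U <= U)%VS].

Definition isotropic_lines (R : realType) (V : vectType R)
    (eta : {symmetric V}) : set {vspace V} :=
  [set L | \dim L = 1%N /\ {in L, forall u, eta u u = 0}].

Definition transitive_on_lines (R : realType) (V : vectType R)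
    (G : set 'End(V)) (X : set {vspace V}) : Prop :=
  forall L1 L2, X L1 -> X L2 -> exists2 g, G g & (g @: L1)%VS = L2.

(* Main.v *)
Require Import Defs.
From HB Require Import structures.
From mathcomp Require Import all_boot all_order all_algebra.
From mathcomp Require Import all_classical all_reals all_analysis.
From mathcomp Require Import ring lra.

Set Implicit Arguments.
Unset Strict Implicit.
Unset Printing Implicit Defensive.

Import Order.TTheory GRing.Theory Num.Theory.
Import numFieldNormedType.Exports.

Local Open Scope classical_set_scope.
Local Open Scope ring_scope.

(* If [G] preserves a proper nondegenerate subspace [U], split [p] along [U] and
   its orthogonal: either one of the two contains [p], hence some but not all of
   the other isotropic lines, or the reflection of [p] in [U] spans a second
   fixed isotropic line; in both cases [G] is not transitive.

   Conversely, in the affine chart of isotropic lines different from [R p], [G]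
   acts on a Euclidean space [E] by similarities. A proper invariant affine
   subspace of [E] would give an invariant subspace of [V] that contains [p] and
   is not orthogonal to it, and such a subspace is nondegenerate. So let [G] be a
   connected group of similarities without proper invariant affine subspace, with
   infinitesimal generators [x |-> x C_v + b_v]. Let [K] be the space of those
   [b_v] with [C_v = 0], and [P] the orthogonal projection with kernel [K]. The
   quadratic function [F x = \sum_i |(x C_i + b_i) P|^2], where [C_i] runs over a
   Frobenius-orthonormal basis of the [C_v], satisfies [F (g x) = c(g)^2 F x], so
   its minimum set is an invariant affine subspace, hence everything. Then
   [C_v P = 0], the tangent space of an orbit does not depend on the point, and
   orbits stay in translates of it by the mean value theorem; so it is [E], orbits
   are open, and the action is transitive. *)

(** * Orthonormal bases and least squares *)

Lemma symmetric_form_of (R : realType) (U : lmodType R) (B : U -> U -> R) :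
  (forall w a u v, B (a *: u + v) w = a * B u w + B v w) ->
  (forall u v, B u v = B v u) ->
  exists B' : {symmetric U}, forall u v, B' u v = B u v.
Proof.
move=> Bl Bsym.
have Blin : bilinear_for (GRing.Scale.Law.clone _ _ *%R _)
    (GRing.Scale.Law.clone _ _ *%R _) B.
  split=> [w|w] a u v /=; first exact: Bl.
  by rewrite [LHS]Bsym Bl -(Bsym w u) -(Bsym w v).
pose m := bilinear_isBilinear.Build R U U R _ _ B Blin.
have Bh : forall u v, B u v = (-1) ^+ false * idfun (B v u).
  by move=> u v; rewrite expr0 mul1r /= Bsym.
pose h := isHermitianSesquilinear.Build R U false idfun B Bh.
pose B' : {symmetric U} := HB.pack B m h.
by exists B'.
Qed.

Lemma sformC (R : realType) (U : lmodType R) (B : {symmetric U}) u v :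
  B u v = B v u.
Proof. by rewrite hermC expr0 mul1r. Qed.

(** [B] is only semidefinite on [W]: the induction stops once every vector of what is left is
    isotropic, so the final remainder is isotropic and not necessarily zero. *)
Lemma gram_schmidt (R : realType) (U : vectType R) (B : {symmetric U})
    (W : {vspace U}) :
  {in W, forall w, 0 <= B w w} ->
  exists (m : nat) (s : 'I_m -> U),
    [/\ forall i, s i \in W, forall i j, B (s i) (s j) = (i == j)%:R &
        {in W, forall w,
          B (w - \sum_i B w (s i) *: s i) (w - \sum_i B w (s i) *: s i) = 0}].
Proof.
have [d] := ubnP (\dim W); elim: d W => // d IH W; rewrite ltnS => dW Wge0.
have [[w wW /eqP wN0]|W0] := pselect (exists2 w, w \in W & B w w <> 0); last first.
  exists 0%N, (fun=> 0); split=> [[]//|[]//|w wW].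
  by rewrite big_ord0 subr0; apply: contrapT => wN0; apply: W0; exists w.
have wgt0 : 0 < B w w by rewrite lt_def wN0 Wge0.
pose e := (Num.sqrt (B w w))^-1 *: w.
have eW : e \in W by rewrite memvZ.
have ee : B e e = 1.
  rewrite /e linearZl_LR linearZr_LR /= mulrA -invfM -expr2 sqr_sqrtr ?ltW//.
  by rewrite mulVf.
have [|x xW|m [s [sW sO sP]]] := IH (W :&: orthov B <[e]>)%VS.
- have /eq_dim_orthov1 <- : e \notin orthov B W.
    by apply/mem_orthovPn; exists e; rewrite // ee oner_neq0.
  rewrite (leq_trans _ dW)// prednK// lt0n dimv_eq0.
  apply: contraNneq (lt0r_neq0 wgt0) => W00.
  by move: wW; rewrite W00 memv0 => /eqP ->; rewrite linear0l.
- by apply: Wge0; move: xW; rewrite memv_cap => /andP[].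
have se i : B (s i) e = 0.
  by have := sW i; rewrite memv_cap mem_orthov1 => /andP[_ /eqP].
exists m.+1, (fun i => if unlift ord0 i is Some j then s j else e); split.
- move=> i; case: unliftP => [j|] _ //.
  by have := sW j; rewrite memv_cap => /andP[].
- move=> i j; case: unliftP => [i'|] ->; case: unliftP => [j'|] ->.
  + by rewrite sO (inj_eq lift_inj).
  + by rewrite se eq_sym (negPf (neq_lift _ _)).
  + by rewrite sformC se (negPf (neq_lift _ _)).
  + by rewrite ee eqxx.
move=> x xW; rewrite big_ord_recl unlift_none.
under eq_bigr do rewrite liftK.
set y := x - B x e *: e.
have yW : y \in (W :&: orthov B <[e]>)%VS.
  rewrite memv_cap rpredB ?memvZ// mem_orthov1 linearBl linearZl_LR /= ee.
  by rewrite mulr1 subrr.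
suff -> : x - (B x e *: e + \sum_(i < m) B x (s i) *: s i) =
    y - \sum_i B y (s i) *: s i by exact: sP.
rewrite opprD addrA; congr (_ - _); apply: eq_bigr => i _.
by rewrite linearBl linearZl_LR /= (sformC B e) se mulr0 subr0.
Qed.

(** * The Frobenius inner product *)

Definition frob (R : realType) (m n : nat) (X Y : 'M[R]_(m, n)) : R :=
  \tr (X *m Y^T).

Section Frobenius.
Variables (R : realType).

Lemma frobE m n (X Y : 'M[R]_(m, n)) : frob X Y = \sum_i \sum_j X i j * Y i j.
Proof. by apply: eq_bigr => i _; rewrite mxE; apply: eq_bigr => j _; rewrite mxE. Qed.

Lemma frobC m n (X Y : 'M[R]_(m, n)) : frob X Y = frob Y X.
Proof. by rewrite /frob -mxtrace_tr trmx_mul trmxK. Qed.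

Lemma frobPl m n (Y : 'M[R]_(m, n)) a X X' :
  frob (a *: X + X') Y = a * frob X Y + frob X' Y.
Proof. by rewrite /frob mulmxDl mxtraceD -scalemxAl mxtraceZ. Qed.

Lemma frobDl m n (X X' Y : 'M[R]_(m, n)) : frob (X + X') Y = frob X Y + frob X' Y.
Proof. by rewrite -[X]scale1r frobPl mul1r scale1r. Qed.

Lemma frob0l m n (Y : 'M[R]_(m, n)) : frob 0 Y = 0.
Proof. by rewrite /frob mul0mx mxtrace0. Qed.

Lemma frobZl m n a (X Y : 'M[R]_(m, n)) : frob (a *: X) Y = a * frob X Y.
Proof. by rewrite -[a *: X]addr0 frobPl frob0l addr0. Qed.

Lemma frob_suml m n I (r : seq I) (F : I -> 'M[R]_(m, n)) Y :
  frob (\sum_(i <- r) F i) Y = \sum_(i <- r) frob (F i) Y.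
Proof.
elim/big_rec2: _ => [|i y x _ <-]; first exact: frob0l.
exact: frobDl.
Qed.

Lemma frobDr m n (X Y Y' : 'M[R]_(m, n)) : frob X (Y + Y') = frob X Y + frob X Y'.
Proof. by rewrite frobC frobDl !(frobC X). Qed.

Lemma frobZr m n a (X Y : 'M[R]_(m, n)) : frob X (a *: Y) = a * frob X Y.
Proof. by rewrite frobC frobZl frobC. Qed.

Lemma frob_sumr m n I (r : seq I) (F : I -> 'M[R]_(m, n)) X :
  frob X (\sum_(i <- r) F i) = \sum_(i <- r) frob X (F i).
Proof. by rewrite frobC frob_suml; apply: eq_bigr => i _; rewrite frobC. Qed.

Lemma frob_ge0 m n (X : 'M[R]_(m, n)) : 0 <= frob X X.
Proof.
by rewrite frobE; do 2!apply: sumr_ge0 => ? _; rewrite -expr2 sqr_ge0.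
Qed.

Lemma frob_eq0 m n (X : 'M[R]_(m, n)) : frob X X = 0 -> X = 0.
Proof.
rewrite frobE => /eqP; rewrite psumr_eq0; last first.
  by move=> i _; apply: sumr_ge0 => j _; rewrite -expr2 sqr_ge0.
move=> /allP X0; apply/matrixP => i j; rewrite mxE.
have := X0 i (mem_index_enum i); rewrite psumr_eq0; last first.
  by move=> l _; rewrite -expr2 sqr_ge0.
by move=> /allP/(_ j (mem_index_enum j)); rewrite mulf_eq0 orbb => /eqP.
Qed.

Lemma frob_sqrD m n (X Y : 'M[R]_(m, n)) : frob X Y = 0 ->
  frob (X + Y) (X + Y) = frob X X + frob Y Y.
Proof. by move=> XY; rewrite frobDl !frobDr (frobC Y X) XY addr0 add0r. Qed.

Lemma frob_mulmxr m n (c : R) (A : 'M[R]_n) (X Y : 'M[R]_(m, n)) :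
  A *m A^T = c%:M -> frob (X *m A) (Y *m A) = c * frob X Y.
Proof.
move=> AA; rewrite /frob trmx_mul mulmxA -(mulmxA X) AA mul_mx_scalar.
by rewrite -scalemxAl mxtraceZ.
Qed.

Lemma frob_mulmxl m n (c : R) (A : 'M[R]_m) (X Y : 'M[R]_(m, n)) :
  A^T *m A = c%:M -> frob (A *m X) (A *m Y) = c * frob X Y.
Proof.
move=> AA; rewrite /frob trmx_mul mulmxA mxtrace_mulC !mulmxA AA mul_scalar_mx.
by rewrite -scalemxAl mxtraceZ.
Qed.

Lemma frob_rows m n (X Y : 'M[R]_(m, n)) :
  frob X Y = \sum_i frob (row i X) (row i Y).
Proof.
rewrite frobE; apply: eq_bigr => i _; rewrite frobE big_ord1.
by apply: eq_bigr => j _; rewrite !mxE.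
Qed.

Lemma frob_linear_form (U : lmodType R) m n (L : {linear U -> 'M[R]_(m, n)}) :
  exists B : {symmetric U}, forall u v, B u v = frob (L u) (L v).
Proof.
apply: symmetric_form_of => [w a u v|u v]; last exact: frobC.
by rewrite linearP frobPl.
Qed.

(** Gram-Schmidt for the pullback of [frob] along [L]. It degenerates on the kernel of [L], but a
    vector isotropic for it is killed by [L], so the [L (s i)] form an orthonormal basis of the
    image of [W]. *)
Lemma frob_gram_schmidt (U : vectType R) m n (L : {linear U -> 'M[R]_(m, n)})
    (W : {vspace U}) :
  exists (d : nat) (s : 'I_d -> U),
    [/\ forall i, s i \in W,
        forall i j, frob (L (s i)) (L (s j)) = (i == j)%:R &
        {in W, forall w, L w = \sum_i frob (L w) (L (s i)) *: L (s i)}].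
Proof.
have [B BE] := frob_linear_form L.
have [w _|d [s [sW sO sP]]] := @gram_schmidt R U B W.
  by rewrite BE frob_ge0.
exists d, s; split => // [i j|w wW]; first by rewrite -BE.
apply/eqP; rewrite -subr_eq0; apply/eqP.
have := sP _ wW; rewrite BE => /frob_eq0.
rewrite linearB linear_sum /=.
by under eq_bigr do rewrite linearZ /= BE.
Qed.

(** Normal equations: [- L x] is the orthogonal projection of [d] on the image of [L]. *)
Lemma least_squares m n p (L : {linear 'rV[R]_n -> 'M[R]_(m, p)}) (d : 'M[R]_(m, p)) :
  exists x, forall y, frob (L x + d) (L y) = 0.
Proof.
have [r [s [_ sO sP]]] := frob_gram_schmidt L fullv.
exists (- \sum_i frob d (L (s i)) *: s i) => y.
rewrite (sP y (memvf y)) frob_sumr big1 // => j _; rewrite frobZr.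
rewrite frobDl linearN linear_sum /= -scaleN1r frobZl frob_suml (bigD1 j)//=.
rewrite big1 => [|i ij]; last by rewrite linearZ frobZl sO (negPf ij) mulr0.
by rewrite linearZ frobZl sO eqxx mulr1 addr0 mulN1r addNr mulr0.
Qed.

End Frobenius.

(** * Infinitesimal similarities *)

Section OrthogonalComplement.
Variables (R : realType) (k n : nat) (b : {linear 'rV[R]_k -> 'rV[R]_n}).
Variable W : {vspace 'rV[R]_k}.

Lemma orthogonal_projection : exists P : 'M[R]_n,
  [/\ {in W, forall u, b u *m P = 0},
      forall y, exists2 u, u \in W & y = y *m P + b u &
      {in W, forall u y, frob (y *m P) (b u) = 0}].
Proof.
have [d [s [sW sO sP]]] := frob_gram_schmidt b W.
pose P : 'M[R]_n := 1%:M - \sum_i (b (s i))^T *m b (s i).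
have PE y : y *m P = y - b (\sum_i frob y (b (s i)) *: s i).
  rewrite /P mulmxBr mulmx1; congr (y - _); rewrite mulmx_sumr linear_sum.
  apply: eq_bigr => i _; rewrite linearZ /= mulmxA [y *m _]mx11_scalar.
  by rewrite mul_scalar_mx /frob trace_mx11.
exists P; split=> [u uW|y|u uW y].
- rewrite PE linear_sum /= [X in X - _](sP u uW).
  by under [X in _ - X]eq_bigr do rewrite linearZ; rewrite subrr.
- exists (\sum_i frob y (b (s i)) *: s i); last by rewrite PE subrK.
  by rewrite rpred_sum// => i _; rewrite rpredZ.
- rewrite (sP u uW) frob_sumr big1 // => j _; rewrite frobZr PE.
  rewrite linear_sum -scaleN1r frobDl frobZl frob_suml (bigD1 j)//= big1.
    by rewrite linearZ frobZl sO eqxx mulr1 addr0 mulN1r subrr mulr0.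
  by move=> i ij; rewrite linearZ frobZl sO (negPf ij) mulr0.
Qed.

End OrthogonalComplement.

(** * An invariant quadratic function and its minimum set *)

Section InvariantAffine.
Variables (R : realType) (k n : nat) (H : Type).
Variables (A : H -> 'M[R]_n) (a : H -> 'rV[R]_n) (c : H -> R) (inv : H -> H).
Variables (C : {linear 'rV[R]_k -> 'M[R]_n}) (b : {linear 'rV[R]_k -> 'rV[R]_n}).

Local Notation act h x := (x *m A h + a h).

Hypothesis simA : forall h, A h *m (A h)^T = (c h)%:M.
Hypothesis c_inv : forall h, c h * c (inv h) = 1.
Hypothesis act_inv : forall h x, act h (act (inv h) x) = x.
(** Adjoint action: [act h] pushes the vector field of [v], with value [x *m C v + b v] at [x],
    forward to the field of [v']. *)
Hypothesis Ad : forall h v, exists v', forall x,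
  act h x *m C v' + b v' = (x *m C v + b v) *m A h.

Let ker := lker (linfun C).

Let kerP u : reflect (C u = 0) (u \in ker).
Proof. by rewrite memv_ker lfunE; apply: eqP. Qed.

Let c_neq0 h : c h != 0.
Proof. by apply/eqP => c0; have := c_inv h; rewrite c0 mul0r => /eqP; rewrite eq_sym oner_eq0. Qed.

Let simAt h : (A h)^T *m A h = (c h)%:M.
Proof.
have : A h *m ((c h)^-1 *: (A h)^T) = 1%:M.
  by rewrite -scalemxAr simA scale_scalar_mx mulVf.
move=> /mulmx1C; rewrite -scalemxAl => /(congr1 (fun X => c h *: X)).
by rewrite scalerA mulfV// scale1r scale_scalar_mx mulr1.
Qed.

Let c_gt0 h : (0 < n)%N -> 0 < c h.
Proof.
move=> n0; rewrite lt_def c_neq0 /=; have := frob_ge0 (row (Ordinal n0) (A h)).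
rewrite frobE big_ord1 => /le_trans; apply.
have := congr1 (fun X : 'M[R]_n => X (Ordinal n0) (Ordinal n0)) (simA h).
rewrite !mxE eqxx mulr1n => <-.
by apply: ler_sum => j _; rewrite !mxE.
Qed.

Let AdC h v v' : (forall x, act h x *m C v' + b v' = (x *m C v + b v) *m A h) ->
  A h *m C v' = C v *m A h /\ a h *m C v' + b v' = b v *m A h.
Proof.
move=> vv'; have := vv' 0; rewrite !mul0mx !add0r => v0; split => //.
apply/row_matrixP => i; rewrite !row_mul rowE.
have := vv' (delta_mx 0 i); rewrite mulmxDl -addrA v0 mulmxDl.
by move=> /addIr ->; rewrite -rowE.
Qed.

(** As [A h] is invertible, the conjugate of an infinitesimal translation is again one; so [A h]
    preserves the space of the vectors [b u] with [C u = 0]. *)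
Lemma translation_stable h u : C u = 0 -> exists2 u', C u' = 0 & b u *m A h = b u'.
Proof.
move=> Cu; have [u' uu'] := Ad h u; have [CA bA] := AdC uu'.
exists u'; last first.
  rewrite -bA; suff -> : C u' = 0 by rewrite mulmx0 add0r.
  apply: (scalerI (c_neq0 h)); rewrite scaler0 -mul_scalar_mx -simAt -mulmxA CA.
  by rewrite Cu mul0mx mulmx0.
apply: (scalerI (c_neq0 h)); rewrite scaler0 -mul_scalar_mx -simAt -mulmxA CA.
by rewrite Cu mul0mx mulmx0.
Qed.

Hypothesis no_invariant_affine : forall (W : {vspace 'rV[R]_n}) x0,
  (forall h x, x - x0 \in W -> act h x - x0 \in W) -> W = fullv.

(* The invariant function [F] is minimal on an affine
   subspace; that subspace being everything, [x *m C v] lies in the kernel of [P]. *)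
Lemma linear_part_in_translations v x : exists2 u, C u = 0 & x *m C v = b u.
Proof.
have [P [bP decP orP]] := orthogonal_projection b ker.
have [m [s [_ sO sP]]] := frob_gram_schmidt C fullv.
pose Y x := \matrix_(i < m) ((x *m C (s i) + b (s i)) *m P).
pose F x := frob (Y x) (Y x).
have rowY y i : row i (Y y) = (y *m C (s i) + b (s i)) *m P by rewrite rowK.
(* The component of [y] in the kernel of [P] is moved by [A h] inside that kernel, and [P] shortens
   the image of the other component. *)
have frobAP h (y : 'rV[R]_n) :
    frob (y *m A h *m P) (y *m A h *m P) <= c h * frob (y *m P) (y *m P).
  have [u /kerP uW yE] := decP y.
  have [u' u'W uA] := translation_stable h uW.
  rewrite -(frob_mulmxr _ _ (simA h)); set z := y *m P *m A h.
  have -> : y *m A h *m P = z *m P.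
    by rewrite {1}yE mulmxDl uA mulmxDl bP ?addr0//; apply/kerP.
  have [w wW zE] := decP z; rewrite [in leRHS]zE frob_sqrD ?orP//.
  by rewrite lerDl frob_ge0.
(* Conjugation by [h] turns the orthonormal family [C (s i)] into an orthonormal family [C (v' i)]
   of the same space; the change of basis [O] is orthogonal and preserves the Frobenius norm of
   [Y]. *)
have FA h x0 : F (act h x0) <= c h * F x0.
  have [v' v'E] : exists v' : 'I_m -> _, forall i x,
      act h x *m C (v' i) + b (v' i) = (x *m C (s i) + b (s i)) *m A h.
    by have /choice[v' v'E] := fun i => Ad h (s i); exists v'.
  pose O := \matrix_(i, j) frob (C (v' i)) (C (s j)) : 'M[R]_m.
  have v'O i j : frob (C (v' i)) (C (v' j)) = (i == j)%:R.
    have [Ci _] := AdC (v'E i); have [Cj _] := AdC (v'E j).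
    apply: (mulfI (c_neq0 h)); rewrite -(frob_mulmxl _ _ (simAt h)) Ci Cj.
    by rewrite (frob_mulmxr _ _ (simA h)) sO.
  have Cv' i : C (v' i) = \sum_j O i j *: C (s j).
    by rewrite (sP _ (memvf _)); apply: eq_bigr => j _; rewrite mxE.
  have OO : O *m O^T = 1%:M.
    apply/matrixP => i j; rewrite !mxE -v'O (Cv' i) frob_suml.
    by apply: eq_bigr => l _; rewrite frobZl !mxE (frobC (C (s l))).
  have OY : O *m Y (act h x0) =
      \matrix_(i < m) ((x0 *m C (s i) + b (s i)) *m A h *m P).
    apply/row_matrixP => i; rewrite rowK -v'E row_mul mulmx_sum_row.
    (* [v' i] is the combination of the [s j] only up to some [r] in the kernel of [C]; the
       contribution [b r] is killed by [P]. *)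
    have [r [Cr ->]] : exists r, C r = 0 /\ v' i = r + \sum_j O i j *: s j.
      exists (v' i - \sum_j O i j *: s j); rewrite subrK linearB linear_sum /= Cv'.
      by under [X in _ - X]eq_bigr do rewrite linearZ; rewrite subrr.
    have rW : r \in ker by apply/kerP.
    rewrite !linearD /= Cr linear0 add0r addrCA.
    rewrite mulmxDl bP// add0r !linear_sum /= -big_split mulmx_suml.
    apply: eq_bigr => j _; rewrite rowY mxE.
    by rewrite !linearZ /= -scalerDr -scalemxAl.
  have -> : F (act h x0) = frob (O *m Y (act h x0)) (O *m Y (act h x0)).
    by rewrite (@frob_mulmxl _ _ _ 1) ?mul1r// mulmx1C.
  rewrite OY /F !frob_rows mulr_sumr; apply: ler_sum => i _.
  by rewrite rowK rowY; exact: frobAP.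
have Llin : linear (fun x : 'rV[R]_n => \matrix_(i < m) (x *m C (s i) *m P)).
  move=> t y z; apply/row_matrixP => i.
  by rewrite linearP /= !rowK !mulmxDl -!scalemxAl.
pose L : {linear 'rV[R]_n -> 'M[R]_(m, n)} :=
  HB.pack (fun x : 'rV[R]_n => \matrix_(i < m) (x *m C (s i) *m P))
   (GRing.isLinear.Build _ _ _ _ _ Llin).
have [x0 x0P] := least_squares L (\matrix_(i < m) (b (s i) *m P)).
have YE y : Y y = L (y - x0) + (L x0 + \matrix_(i < m) (b (s i) *m P)).
  rewrite addrA -linearD subrK; apply/row_matrixP => i.
  by rewrite linearD /= !rowK mulmxDl.
(* Pythagoras at the least-squares point [x0]: the minimum set of [F] is [x0] plus the kernel of
   [L]. *)
have FE y : F y = F x0 + frob (L (y - x0)) (L (y - x0)).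
  rewrite /F !YE subrr linear0 add0r frob_sqrD 1?addrC//.
  by rewrite frobC x0P.
have F0 y : F x0 <= F y by rewrite [leRHS]FE lerDl frob_ge0.
have [n0|n0] := posnP n.
  exists 0; rewrite !linear0//; apply/rowP => i.
  by have := ltn_ord i; rewrite {2}n0.
have Wfull : lker (linfun L) = fullv.
  apply: (no_invariant_affine (x0 := x0)) => h y; rewrite !memv_ker !lfunE /=.
  move=> /eqP Ly.
  have Fy : F y = F x0 by rewrite FE [L _]Ly frob0l addr0.
  (* Going to [act (inv h) x0] and back costs the factor [c (inv h) * c h = 1], and [F] is minimal
     at [x0]; hence [c h * F x0 <= F x0]. *)
  have : F (act h y) <= F x0.
    rewrite (le_trans (FA h y))// Fy.
    have := le_trans (F0 (act (inv h) x0)) (FA (inv h) x0).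
    move=> F0c; have := FA h (act (inv h) x0); rewrite act_inv => F1.
    rewrite (le_trans (ler_wpM2l (ltW (c_gt0 h n0)) (F0 (act (inv h) x0))))//.
    rewrite (le_trans (ler_wpM2l (ltW (c_gt0 h n0)) (FA (inv h) x0)))//.
    by rewrite mulrA c_inv mul1r.
  rewrite FE gerDl => Lle; apply/eqP/frob_eq0/eqP.
  by rewrite eq_le Lle frob_ge0.
have LCv (y : 'rV[R]_n) i : y *m C (s i) *m P = 0.
  have /eqP/row_matrixP/(_ i) : linfun L y == 0 by rewrite -memv_ker Wfull memvf.
  by rewrite lfunE /= rowK linear0.
have [u /kerP Cu xE] := decP (x *m C v); exists u => //.
rewrite xE (sP v (memvf v)) mulmx_sumr mulmx_suml big1 ?add0r// => i _.
by rewrite -scalemxAr -scalemxAl LCv scaler0.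
Qed.

End InvariantAffine.

(** * Local surjectivity *)

Section Calculus.
Variables (R : realType).

Lemma is_derive_line (U : normedModType R) (f : U -> R) (w v : U) (t : R) :
  differentiable f (w + t *: v) ->
  is_derive t 1 (fun s : R => f (w + s *: v)) ('D_v f (w + t *: v)).
Proof.
move=> df; pose l s := w + s *: v.
have dl : is_diff t l ( *:%R^~ v).
  have -> : l = cst w + ( *:%R^~ v) by apply/funext.
  by apply: is_diff_eq; rewrite add0r.
have dlt : differentiable l t by exact: ex_diff.
have dfl : differentiable (f \o l) t.
  exact: differentiable_comp.
apply: DeriveDef; first exact: diff_derivable.
rewrite deriveE// (@diff_comp _ _ _ _ l f)//.
by rewrite diff_val /= scale1r deriveE.
Qed.

Lemma mean_value_line (U : normedModType R) (f : U -> R) (w v : U) :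
  (forall t : R, 0 <= t <= 1 -> differentiable f (w + t *: v)) ->
  exists2 t : R, 0 <= t <= 1 & f (w + v) - f w = 'D_v f (w + t *: v).
Proof.
move=> df; pose g s := f (w + s *: v).
have dg (t : R) : 0 <= t <= 1 -> is_derive t 1 g ('D_v f (w + t *: v)).
  by move=> /df; exact: is_derive_line.
have [||c + gc] := @MVT_segment R g (fun t => 'D_v f (w + t *: v)) 0 1 ler01.
- by move=> x; rewrite in_itv /= => /andP[/ltW x0 /ltW x1]; apply: dg; apply/andP.
- apply: derivable_within_continuous => x; rewrite in_itv => /dg dgx.
  exact: ex_derive.
rewrite in_itv /= => c01; exists c => //.
by move: gc; rewrite /g scale0r addr0 scale1r subr0 mulr1.
Qed.

Section LocalSurjectivity.
Variables (k n : nat) (f : 'I_n -> 'rV[R]_k -> R) (w0 : 'rV[R]_k).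
Variables (s : 'I_n -> 'rV[R]_k) (rho : R).
Hypothesis rho_gt0 : 0 < rho.
(** With this value [n * eps <= 1 / 2], so the derivative of [f] along [S] differs from the identity
    by at most half in the maximum norm. *)
Let eps : R := (2 * n.+1%:R)^-1.

Hypothesis df : forall w, `|w - w0| < rho -> forall j, differentiable (f j) w.
Hypothesis Df : forall w, `|w - w0| < rho -> forall i j,
  `|'D_(s i) (f j) w - (i == j)%:R| <= eps.

Let S (y : 'rV[R]_n) := w0 + \sum_i y 0 i *: s i.

(** Half side of a cube that [S] maps into the open ball of radius [rho]; the summand 1 keeps the
    denominator positive and the inclusion strict. *)
Let r := rho / (1 + \sum_i `|s i|).

Let K := [set y : 'rV[R]_n | forall i, `|y 0 i| <= r].

Let s_gt0 : 0 < 1 + \sum_i `|s i|.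
Proof. by rewrite ltr_pwDl// sumr_ge0. Qed.

Let r_gt0 : 0 < r. Proof. by rewrite divr_gt0. Qed.

Let SK y : K y -> `|S y - w0| < rho.
Proof.
move=> Ky; rewrite /S addrC addKr (le_lt_trans (ler_norm_sum _ _ _))//.
rewrite (@le_lt_trans _ _ (r * \sum_i `|s i|))//.
  rewrite mulr_sumr; apply: ler_sum => i _.
  by rewrite normrZ ler_wpM2r.
by rewrite /r mulrAC ltr_pdivrMr// ltr_pM2l// ltrDr.
Qed.

Let SD y t u : S (y + t *: u) = S y + t *: \sum_i u 0 i *: s i.
Proof.
rewrite /S -addrA scaler_sumr -big_split; congr (_ + _).
by apply: eq_bigr => i _; rewrite !mxE scalerDl scalerA.
Qed.

Let DfS w (u : 'rV[R]_n) j : `|w - w0| < rho ->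
  'D_(\sum_i u 0 i *: s i) (f j) w = \sum_i u 0 i * 'D_(s i) (f j) w
  :> R.
Proof.
move=> ww; have dfw := df ww j; rewrite deriveE// linear_sum.
by apply: eq_bigr => i _; rewrite linearZ deriveE.
Qed.

Let DfSE w (u : 'rV[R]_n) j M : `|w - w0| < rho -> (forall i, `|u 0 i| <= M) ->
  `|'D_(\sum_i u 0 i *: s i) (f j) w - u 0 j| <= M / 2.
Proof.
move=> ww uM; rewrite DfS//.
have -> : u 0 j = \sum_i u 0 i * (i == j)%:R.
  rewrite (bigD1 j)//= eqxx mulr1 big1 ?addr0// => i /negPf ->.
  by rewrite mulr0.
rewrite -sumrB (le_trans (ler_norm_sum _ _ _))//.
apply: (@le_trans _ _ (\sum_(i < n) M * eps)).
  apply: ler_sum => i _; rewrite -mulrBr normrM.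
  by apply: ler_pM => //; exact: Df.
have M0 : 0 <= M by rewrite (le_trans _ (uM j)).
rewrite sumr_const card_ord -[leLHS]mulr_natr -mulrA ler_wpM2l// /eps invfM -mulrA.
by rewrite ler_piMr ?invr_ge0// ler_pdivrMl ?ltr0n// mulr1 ler_nat.
Qed.

(** Since [r / 2 = n.+2%:R * delta], at a boundary point of the cube some coordinate misses [z] by
    more than [n.+1%:R * delta], whereas the centre gives a sum of squares at most
    [n%:R * delta ^+ 2]. *)
Let delta := r / (2 * n.+2%:R).

Let delta_gt0 : 0 < delta. Proof. by apply: divr_gt0; [exact: r_gt0|rewrite mulr_gt0 ?ltr0n]. Qed.

(* A minimiser [y] of [|f (S y) - z|^2] on the cube [K] is interior because [f \o S]
   is close to a translate of the identity; the derivative along [f (S y) - z]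
   itself then vanishes, which forces [f (S y) = z]. *)
Lemma local_surjectivity z : (forall j, `|z j - f j w0| < delta) ->
  exists2 w, `|w - w0| < rho & forall j, f j w = z j.
Proof.
move=> zw0; pose N y := \sum_j (f j (S y) - z j) ^+ 2.
have K0 : K 0 by move=> i; rewrite mxE normr0 ltW.
have S0 : S 0 = w0.
  by rewrite /S big1 ?addr0// => i _; rewrite mxE scale0r.
have dS y : differentiable S y.
  have -> : S = cst w0 + \sum_i (fun y : 'rV[R]_n => y 0 i *: s i).
    by apply/funext => x; rewrite /S /= -[RHS]/(w0 + _) fct_sumE.
  apply: differentiableD => //; apply: differentiable_sum => i.
  apply: differentiableZl; exact: differentiable_coord.
have cK : compact K.
  have -> : K = [set y : 'rV[R]_n | forall i, y ord0 i \in `[(- r), r]].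
    by apply/seteqP; split=> y /= Ky i; have := Ky i; rewrite in_itv /= ler_norml.
  apply: (@rV_compact _ _ (fun=> `[(- r), r]%classic)) => _.
  exact: segment_compact.
have cN : {within K, continuous N}.
  apply: continuous_in_subspaceT => y; rewrite inE => Ky.
  suff : differentiable N y by exact: differentiable_continuous.
  rewrite /N; have -> : (fun y => \sum_j (f j (S y) - z j) ^+ 2) =
    \sum_j ((f j \o S) - cst (z j)) ^+ 2 by apply/funext => x; rewrite fct_sumE.
  apply: differentiable_sum => j; apply: differentiableX.
  apply: differentiableB => //; apply: differentiable_comp => //.
  exact: (df (SK Ky)).
have [|y yK ymin] := EVT_min_rV _ cK cN; first by exists 0.
have {}yK : K y by move: yK; rewrite inE.
have {}ymin x : K x -> N y <= N x by move=> Kx; apply: ymin; rewrite inE.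
(* If a coordinate reached [r], the mean value theorem from [0] to [y] would give [N 0 < N y]. *)
have yint i : `|y 0 i| < r.
  rewrite lt_neqAle yK andbT; apply/eqP => yr.
  have [t t01 ft] : exists2 t : R, 0 <= t <= 1 & f i (S y) - f i w0 =
      'D_(\sum_i y 0 i *: s i) (f i) (S (t *: y)).
    have tY t : w0 + t *: \sum_i y 0 i *: s i = S (t *: y).
      by rewrite -{1}S0 -SD add0r.
    have [|t t01 ft] := @mean_value_line _ (f i) w0 (\sum_i y 0 i *: s i).
      move=> t /andP[t0 t1]; apply: df; rewrite tY; apply: SK.
      move=> l; rewrite mxE normrM (ger0_norm t0).
      by rewrite (le_trans _ (yK l))// ler_piMl.
    by exists t => //; rewrite -tY -ft.
  have KtY : K (t *: y).
    move=> l; rewrite mxE normrM; case/andP: t01 => t0 t1; rewrite (ger0_norm t0).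
    by rewrite (le_trans _ (yK l))// ler_piMl.
  have fr := DfSE i (SK KtY) yK; rewrite -ft in fr.
  have N0 : N 0 <= n%:R * delta ^+ 2.
    rewrite /N S0 -[n in leRHS]card_ord -sumr_const mulr_suml.
    apply: ler_sum => j _; rewrite mul1r -real_normK ?num_real//.
    by rewrite lerXn2r ?nnegrE// ?(ltW delta_gt0)// distrC ltW.
  have nd0 : 0 <= n.+1%:R * delta by apply: mulr_ge0 => //; exact: ltW.
  have Ny : (n.+1%:R * delta) ^+ 2 < N y.
    rewrite /N (bigD1 i)//= ltr_wpDr//; first by apply: sumr_ge0 => j _; exact: sqr_ge0.
    rewrite -[ltRHS]real_normK ?num_real// ltrXn2r ?nnegrE//.
    have rE : r = delta * (2 * n.+2%:R) by rewrite /delta mulfVK// mulf_neq0.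
    have nE : n.+2%:R = n.+1%:R + 1 :> R by rewrite -[n.+2]addn1 natrD.
    have : `|y 0 i| <= `|f i (S y) - z i| + `|z i - f i w0|
       + `|f i (S y) - f i w0 - y 0 i|.
      have yE : y 0 i = (f i (S y) - z i) + (z i - f i w0)
        - (f i (S y) - f i w0 - y 0 i) by ring.
      by rewrite [in leLHS]yE (le_trans (ler_normB _ _))// lerD2r ler_normD.
    have := zw0 i; rewrite yr rE nE => zz ee; rewrite rE nE in fr; lra.
  have := lt_le_trans Ny (le_trans (ymin _ K0) N0).
  rewrite exprMn ltr_pM2r ?exprn_gt0// => /ltW; rewrite -natrX ler_nat.
  by rewrite leqNgt expnS expn1 (leq_trans (ltnSn n))// leq_pmulr.
exists (S y); first exact: SK.
pose u : 'rV[R]_n := \row_j (f j (S y) - z j).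
have [tau tau0 Ktau] : exists2 tau : R, 0 < tau & forall t : R, `|t| < tau ->
    K (y + t *: u).
  have : \forall t \near (0 : R), forall i, `|(y + t *: u) 0 i| < r.
    apply: (@filter_forall _ _ (fun i (t : R) => `|(y + t *: u) 0 i| < r) (nbhs (0 : R))).
    move=> i; apply: (cvgr_lt `|y 0 i|); last exact: yint.
    apply: cvg_norm.
    have -> : (fun t : R => (y + t *: u) 0 i) = (fun t => y 0 i + t * u 0 i).
      by apply/funext => t; rewrite !mxE.
    rewrite -[X in _ --> X]addr0 -[X in _ --> _ + X](mul0r (u 0 i)).
    by apply: cvgD; [exact: cvg_cst|apply: cvgMr_tmp; exact: cvg_id].
  move=> /nbhs_ballP[tau /= tau0 Kt]; exists tau => // t tt i.
  by apply/ltW/Kt; rewrite /ball /= sub0r normrN.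
pose g (t : R) := N (y + t *: u).
have dg (t : R) : `|t| < tau -> is_derive t 1 g
    (\sum_j 2 * (f j (S (y + t *: u)) - z j) *
       'D_(\sum_i u 0 i *: s i) (f j) (S (y + t *: u))).
  move=> tt; pose h j (t : R) := f j (S y + t *: \sum_i u 0 i *: s i).
  have -> : g = \sum_j (h j - cst (z j)) ^+ 2.
    by apply/funext => x; rewrite fct_sumE /g /N; apply: eq_bigr => j _; rewrite SD.
  apply: is_derive_sum => j.
  have dh : is_derive t 1 (h j)
      ('D_(\sum_i u 0 i *: s i) (f j) (S (y + t *: u))).
    by rewrite SD; apply: is_derive_line; apply: df; have := SK (Ktau _ tt); rewrite SD.
  apply: is_derive_eq; rewrite subr0.
  by rewrite SD /= expr1.
have g0 : \sum_j 2 * u 0 j * 'D_(\sum_i u 0 i *: s i) (f j) (S y) = 0.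
  have tE (t : R) : t \in `](- tau), tau[ = (`|t| < tau) by rewrite in_itv /= -ltr_norml.
  have [||||_] := @derive1_at_min R g (- tau) tau 0.
  - by rewrite ge0_cp ?ltW.
  - by move=> t; rewrite tE => /dg dgt; exact: ex_derive.
  - by rewrite tE normr0.
  - by move=> t; rewrite tE => tt; rewrite /g scale0r addr0; apply/ymin/Ktau.
  have dg0 := dg 0; rewrite normr0 in dg0; rewrite (@derive_val _ _ _ _ _ _ _ (dg0 tau0)).
  rewrite scale0r addr0 => gE; rewrite -[RHS]gE.
  by apply: eq_bigr => j _; rewrite mxE.
move=> j.
(* Cross terms are bounded by [2 |a| |b| <= a^2 + b^2]; summed over [l], the bound is [eps * n]
   times the square of [u], at most half of that square. *)
have uE l : u 0 l * u 0 l - u 0 l * 'D_(\sum_i u 0 i *: s i) (f l) (S y) <=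
    \sum_i eps * ((u 0 i ^+ 2 + u 0 l ^+ 2) / 2).
  rewrite DfS; last exact: SK.
  have -> : u 0 l * u 0 l = u 0 l * \sum_i u 0 i * (i == l)%:R.
    rewrite (bigD1 l)//= eqxx mulr1 big1 ?addr0// => i /negPf ->.
    by rewrite mulr0.
  rewrite -mulrBr -sumrB mulr_sumr; apply: ler_sum => i _.
  rewrite -mulrBr mulrA; have /(_ i l) := Df (SK yK).
  rewrite -[leLHS]normrN opprB; set G := _ - 'D_ _ _ _ => Geps.
  apply: le_trans (ler_norm _) _; rewrite normrM mulrC.
  apply: ler_pM => //; rewrite normrM.
  have := sqr_ge0 (`|u 0 l| - `|u 0 i|).
  rewrite -[u 0 i ^+ 2]real_normK ?num_real// -[u 0 l ^+ 2]real_normK ?num_real//.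
  by rewrite sqrrB; lra.
have u0 : \sum_j u 0 j ^+ 2 <= 0.
  pose q := \sum_j u 0 j ^+ 2.
  suff : q <= eps * n%:R * q.
    have q0 : 0 <= q by apply: sumr_ge0 => i _; exact: sqr_ge0.
    have epsn : eps * n%:R <= 2^-1.
      rewrite /eps invfM -mulrA ler_piMr ?invr_ge0// ler_pdivrMl ?ltr0n// mulr1.
      by rewrite ler_nat.
    by move=> qq; have := ler_wpM2r q0 epsn; rewrite -/q; lra.
  have gs : \sum_j u 0 j * 'D_(\sum_i u 0 i *: s i) (f j) (S y) = 0.
    apply: (mulfI (_ : 2 != 0 :> R)) => //; rewrite mulr0 -[RHS]g0 mulr_sumr.
    by apply: eq_bigr => l _; rewrite mulrA.
  have qE : q = \sum_j (u 0 j ^+ 2 - u 0 j * 'D_(\sum_i u 0 i *: s i) (f j) (S y)).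
    by rewrite sumrB gs subr0.
  have -> : eps * n%:R * q = \sum_l \sum_i eps * ((u 0 i ^+ 2 + u 0 l ^+ 2) / 2).
    under eq_bigr do rewrite -mulr_sumr -mulr_suml big_split /= sumr_const card_ord.
    rewrite -mulr_sumr -mulr_suml big_split /= sumr_const card_ord -sumrMnl.
    by rewrite !sumrMnl -/q -mulr_natr; field.
  by rewrite qE; apply: ler_sum => l _; rewrite expr2 uE.
have := u0; rewrite le_eqVlt ltNge sumr_ge0 ?orbF => [/eqP/eqP|i _]; last exact: sqr_ge0.
rewrite psumr_eq0 => [/allP/(_ j (mem_index_enum j))|i _]; last exact: sqr_ge0.
by rewrite sqrf_eq0 mxE subr_eq0 => /eqP.
Qed.

End LocalSurjectivity.
End Calculus.

(** * Lie groups *)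

Section LieGroups.
Variables (R : realType).

Lemma near_eq_differentiable (V W : normedModType R) (f g : V -> W) (x : V) :
  (\near x, f x = g x) -> differentiable f x -> differentiable g x.
Proof.
move=> fg df; have [dfc fE] := (diff_locallyP _ _).1 df.
have gE : g \o shift x = cst (g x) + 'd f x +o_ 0 id.
  have fg0 : \forall y \near (0 : V), f (y + x) = g (y + x).
    by have := fg; rewrite (near_shift 0 x) subr0.
  apply/eqaddoP => e e0; move/eqaddoP : fE => /(_ e e0) fE.
  apply: filterS2 fg0 fE.
  move=> y fgy.
  have -> : (f \o shift x - (cst (f x) + 'd f x)) y = f (y + x) - (f x + 'd f x y) by [].
  have -> : (g \o shift x - (cst (g x) + 'd f x)) y = g (y + x) - (g x + 'd f x y) by [].
  by rewrite fgy (nbhs_singleton fg).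
apply/diff_locallyP; split; first by rewrite (diff_unique dfc gE).
by rewrite (diff_unique dfc gE).
Qed.

Variables (k : nat) (H : groupTopologicalType) (atlas : set (chart R k H)).
Hypothesis lieH : is_lie_group atlas.

Lemma chart_dom_near (c : chart R k H) (x : H) : chart_dom c x ->
  \forall y \near x, chart_dom c y.
Proof. by move=> cx; apply: open_nbhs_nbhs; split => //; exact: chart_dom_open. Qed.

Lemma mulg_continuous_l (x h : H) : {for x, continuous (fun y : H => (h * y)%g)}.
Proof.
apply: (@continuous_comp _ _ _ (fun y => (h, y)) (fun z : H * H => (z.1 * z.2)%g)).
  by apply: cvg_pair; [exact: cvg_cst|exact: cvg_id].
exact: lie_mul_continuous lieH _.
Qed.

Lemma mulg_continuous_r (x h : H) : {for x, continuous (fun y : H => (y * h)%g)}.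
Proof.
apply: (@continuous_comp _ _ _ (fun y => (y, h)) (fun z : H * H => (z.1 * z.2)%g)).
  by apply: cvg_pair; [exact: cvg_id|exact: cvg_cst].
exact: lie_mul_continuous lieH _.
Qed.

(** Smoothness of the product is available in charts, so the two multiplications are done one at a
    time, through a chart around [h1 * chart_inv c w]. *)
Lemma translation_differentiable (h1 h2 : H) (c e : chart R k H) w :
  atlas c -> atlas e -> chart_img c w ->
  chart_dom e (h1 * chart_inv c w * h2)%g ->
  differentiable (fun w' => chart_map e (h1 * chart_inv c w' * h2)%g) w.
Proof.
move=> ac ae cw ew.
have [a1 aa1 a1h1] := lie_atlas_cover lieH h1.
have [b ab bh2] := lie_atlas_cover lieH h2.
have [a aa ah] := lie_atlas_cover lieH (h1 * chart_inv c w)%g.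
have dmul := fun a b c aa ab ac => (lie_mul_smooth lieH (a := a) (b := b) (c := c) aa ab ac 1%N).1.
have d1 : differentiable (fun w' => chart_map a (h1 * chart_inv c w')%g) w.
  have := dmul a1 c a aa1 ac aa (chart_map a1 h1, w).
  have mK : chart_inv a1 (chart_map a1 h1) = h1 by apply: chart_mapK; rewrite inE.
  rewrite inE /= mK => /(_ (And3 (chart_map_fun a1h1) cw ah)) d.
  have /differentiable_comp/(_ d) : differentiable (fun w' => (chart_map a1 h1, w')) w.
    by apply: differentiable_pair; [exact: differentiable_cst|exact: ex_diff].
  by rewrite /comp /= mK.
have d2 : differentiable (fun w' => chart_map e (chart_inv a w' * h2)%g)
    (chart_map a (h1 * chart_inv c w)%g).
  have := dmul a b e aa ab ae (chart_map a (h1 * chart_inv c w)%g, chart_map b h2).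
  have mK : chart_inv b (chart_map b h2) = h2 by apply: chart_mapK; rewrite inE.
  have mKa : chart_inv a (chart_map a (h1 * chart_inv c w)%g) =
    (h1 * chart_inv c w)%g by apply: chart_mapK; rewrite inE.
  rewrite inE /= mK mKa => /(_ (And3 (chart_map_fun ah) (chart_map_fun bh2) ew)) d.
  have /differentiable_comp/(_ d) : differentiable (fun w' => (w', chart_map b h2))
      (chart_map a (h1 * chart_inv c w)%g).
    by apply: differentiable_pair; [exact: ex_diff|exact: differentiable_cst].
  by rewrite /comp /= mK.
apply: (near_eq_differentiable _ (differentiable_comp d1 d2)).
have : \forall w' \near w, chart_dom a (h1 * chart_inv c w')%g.
  have cc : {for w, continuous (fun w' => (h1 * chart_inv c w')%g)}.
    apply: continuous_comp; last exact: mulg_continuous_l.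
    by apply: chart_inv_continuous; rewrite inE.
  exact: cc (chart_dom_near ah).
by apply: filterS => w' aw' /=; rewrite chart_mapK ?inE.
Qed.

Lemma translation_continuous (h1 h2 : H) (c : chart R k H) w : chart_img c w ->
  {for w, continuous (fun w' => h1 * chart_inv c w' * h2)%g}.
Proof.
move=> cw; apply: (@continuous_comp _ _ _ (fun w' => h1 * chart_inv c w')%g
  (fun x => x * h2)%g); last exact: mulg_continuous_r.
apply: continuous_comp; last exact: mulg_continuous_l.
by apply: chart_inv_continuous; rewrite inE.
Qed.

(** Chain rule: [v'] is the image of [v] under the differential of the two-sided translation read in
    charts, hence the same for all [f]. *)
Lemma derive_translation (h1 h2 : H) (c e : chart R k H) w v :
  atlas c -> atlas e -> chart_img c w ->
  chart_dom e (h1 * chart_inv c w * h2)%g ->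
  exists v', forall f : H -> R,
    differentiable (f \o chart_inv e) (chart_map e (h1 * chart_inv c w * h2)%g) ->
    'D_v (fun w' => f (h1 * chart_inv c w' * h2)%g) w =
    'D_v' (f \o chart_inv e) (chart_map e (h1 * chart_inv c w * h2)%g).
Proof.
move=> ac ae cw ew; pose psi w' := chart_map e (h1 * chart_inv c w' * h2)%g.
have dpsi : differentiable psi w by exact: translation_differentiable.
exists ('d psi w v) => f df.
have -> : 'D_v (fun w' => f (h1 * chart_inv c w' * h2)%g) w =
    'D_v ((f \o chart_inv e) \o psi) w.
  apply: near_eq_derive.
  have : \forall w' \near w, chart_dom e (h1 * chart_inv c w' * h2)%g.
    exact: (translation_continuous cw (chart_dom_near ew)).
  by apply: filterS => w' ew' /=; rewrite chart_mapK ?inE.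
rewrite deriveE; last exact: differentiable_comp.
by rewrite diff_comp// deriveE.
Qed.

(** * Continuously differentiable functions on a Lie group, and open subgroups *)

Definition C1_function (f : H -> R) := forall c, atlas c ->
  forall w, chart_img c w -> differentiable (f \o chart_inv c) w /\
    forall v, {for w, continuous ('D_v (f \o chart_inv c))}.

Lemma chart_img_near (c : chart R k H) w : chart_img c w ->
  \forall w' \near w, chart_img c w'.
Proof. by move=> cw; apply: open_nbhs_nbhs; split => //; exact: chart_img_open. Qed.

Lemma near_eq_continuous (U V : topologicalType) (f g : U -> V) (x : U) :
  (\forall y \near x, f y = g y) -> {for x, continuous f} -> {for x, continuous g}.
Proof.
move=> fg cf; rewrite /prop_for /continuous_at -(nbhs_singleton fg).
apply: cvg_trans cf; apply: near_eq_cvg.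
by apply: filterS fg => y ->.
Qed.

Lemma C1_cst (r : R) : C1_function (cst r).
Proof.
move=> c ac w cw; split; first exact: differentiable_cst.
move=> v; have -> : 'D_v (cst r \o chart_inv c) = cst 0.
  by apply/funext => w'; exact: derive_cst.
exact: cst_continuous.
Qed.

Lemma C1_add (f g : H -> R) : C1_function f -> C1_function g ->
  C1_function (fun h => f h + g h).
Proof.
move=> hf hg c ac w cw; have [df cf] := hf c ac w cw; have [dg cg] := hg c ac w cw.
split; first exact: differentiableD.
move=> v; apply: (@near_eq_continuous _ _
    ('D_v (f \o chart_inv c) + 'D_v (g \o chart_inv c))); last first.
  by apply: continuousD; [exact: cf|exact: cg].
apply: filterS (chart_img_near cw) => w' cw'.
have [df' _] := hf c ac w' cw'; have [dg' _] := hg c ac w' cw'.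
by rewrite -[LHS]/('D_v (f \o chart_inv c) w' + 'D_v (g \o chart_inv c) w') -deriveD//;
  exact: diff_derivable.
Qed.

Lemma C1_mul (f g : H -> R) : C1_function f -> C1_function g ->
  C1_function (fun h => f h * g h).
Proof.
move=> hf hg c ac w cw; have [df cf] := hf c ac w cw; have [dg cg] := hg c ac w cw.
split; first exact: differentiableM.
move=> v; apply: (@near_eq_continuous _ _
    (fun w => (f \o chart_inv c) w * 'D_v (g \o chart_inv c) w +
      (g \o chart_inv c) w * 'D_v (f \o chart_inv c) w)); last first.
  apply: continuousD; apply: continuousM; [|exact: cg| |exact: cf].
    exact: differentiable_continuous.
  exact: differentiable_continuous.
apply: filterS (chart_img_near cw) => w' cw'.
have [df' _] := hf c ac w' cw'; have [dg' _] := hg c ac w' cw'.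
by rewrite [RHS](@deriveM _ _ (f \o chart_inv c) (g \o chart_inv c))//;
  exact: diff_derivable.
Qed.

Lemma C1_sum (I : Type) (s : seq I) (f : I -> H -> R) :
  (forall i, C1_function (f i)) -> C1_function (fun h => \sum_(i <- s) f i h).
Proof.
move=> hf; elim: s => [|i s IH].
  have -> : (fun h => \sum_(i <- [::]) f i h) = cst 0.
    by apply/funext => h; rewrite big_nil.
  exact: C1_cst.
have -> : (fun h => \sum_(i <- i :: s) f i h) = (fun h => f i h + \sum_(i <- s) f i h).
  by apply/funext => h; rewrite big_cons.
exact: C1_add.
Qed.

(** The coset of [P] around a point outside [P] avoids [P], so [P] is closed as well as open. *)
Lemma open_subgroup_full (P : set H) : connected [set: H] ->
  nbhs (1%g : H) P -> (forall x y, P x -> P y -> P (x * y)%g) ->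
  (forall x, P x -> P (x^-1)%g) -> forall x, P x.
Proof.
move=> cH P1 PM PV.
have near_coset x : \forall y \near x, P (y * x^-1)%g.
  by apply: mulg_continuous_r; rewrite mulgV.
suff -> : P = setT by [].
apply: cH; first by exists 1%g; exact: nbhs_singleton P1.
- exists P; last by rewrite setTI.
  rewrite openE => x Px; apply: filterS (near_coset x) => y Py.
  by rewrite -[y](mulgVK x) /=; exact: PM.
- exists P; last by rewrite setTI.
  rewrite -openC openE => x nPx; apply: filterS (near_coset x) => y Pyx Py.
  apply: nPx; have -> : x = ((y * x^-1)^-1 * y)%g by rewrite invgM invgK mulgVK.
  by apply: PM => //; exact: PV.
Qed.

End LieGroups.

(** * Connected groups of similarities *)

Section TransitiveAffineActions.
Variables (R : realType).

Lemma is_derive_affine (U : normedModType R) (m : nat) (x : 'I_m -> R)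
    (f : 'I_m -> U -> R) (g : U -> R) (w v : U) :
  (forall i, derivable (f i) w v) -> derivable g w v ->
  is_derive w v (fun w => \sum_i x i * f i w + g w)
    (\sum_i x i * 'D_v (f i) w + 'D_v g w).
Proof.
move=> df dg.
have -> : (fun w => \sum_i x i * f i w + g w) = \sum_i (x i *: f i) + g.
  by apply/funext => y; rewrite /= -[RHS]/((\sum_i x i *: f i) y + g y) fct_sumE.
apply: is_deriveD; last exact: derivableP.
by apply: is_derive_sum => i; apply: is_deriveZ; exact: derivableP.
Qed.

Variables (k n : nat) (H : groupTopologicalType) (atlas : set (chart R k H)).
Hypotheses (lieH : is_lie_group atlas) (connH : connected [set: H]).
Variables (A : H -> 'M[R]_n) (a : H -> 'rV[R]_n) (c : H -> R).

Local Notation act h x := (x *m A h + a h).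

Hypothesis C1A : forall i j, C1_function atlas (fun h => A h i j).
Hypothesis C1a : forall j, C1_function atlas (fun h => a h 0 j).
Hypothesis act1 : forall x, act 1%g x = x.
Hypothesis actM : forall g h x, act (g * h)%g x = act g (act h x).
Hypothesis simA : forall h, A h *m (A h)^T = (c h)%:M.
Hypothesis c_inv : forall h, c h * c (h^-1)%g = 1.
Hypothesis no_invariant_affine : forall (W : {vspace 'rV[R]_n}) x0,
  (forall h x, x - x0 \in W -> act h x - x0 \in W) -> W = fullv.

Let actE h x j : act h x 0 j = \sum_i x 0 i * A h i j + a h 0 j.
Proof. by rewrite !mxE. Qed.

Let C1act x j : C1_function atlas (fun h => act h x 0 j).
Proof.
have -> : (fun h => act h x 0 j) = (fun h => \sum_i x 0 i * A h i j + a h 0 j).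
  by apply/funext => h; rewrite actE.
apply: C1_add; last exact: C1a.
by apply: C1_sum => i; apply: C1_mul; [exact: C1_cst|exact: C1A].
Qed.

Variable e : chart R k H.
Hypotheses (ae : atlas e) (e1 : chart_dom e 1%g).

Local Notation w0 := (chart_map e 1%g).

Let ew0 : chart_img e w0. Proof. exact: (chart_map_fun e1). Qed.

Let inv_w0 : chart_inv e w0 = 1%g. Proof. by apply: chart_mapK; rewrite inE. Qed.

(** Linear and translation parts of the infinitesimal generator attached to the tangent vector [v]
    at the identity, read in the chart [e]. *)
Definition tangent_linear v : 'M[R]_n :=
  \matrix_(i, j) 'D_v ((fun h => A h i j) \o chart_inv e) w0.
Definition tangent_translation v : 'rV[R]_n :=
  \row_j 'D_v ((fun h => a h 0 j) \o chart_inv e) w0.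

Local Notation C := tangent_linear.
Local Notation b := tangent_translation.

Lemma tangent_linear_linear : linear tangent_linear.
Proof.
move=> t u v; apply/matrixP => i j; rewrite !mxE.
have [dA _] := C1A i j ae ew0.
by rewrite !deriveE// linearP.
Qed.

Lemma tangent_translation_linear : linear tangent_translation.
Proof.
move=> t u v; apply/rowP => j; rewrite !mxE.
have [da _] := C1a j ae ew0.
by rewrite !deriveE// linearP.
Qed.

Lemma derive_act x j v :
  'D_v ((fun h => act h x 0 j) \o chart_inv e) w0 = (x *m C v + b v) 0 j.
Proof.
have -> : (fun h => act h x 0 j) \o chart_inv e = (fun w => \sum_i x 0 i *
    ((fun h => A h i j) \o chart_inv e) w + ((fun h => a h 0 j) \o chart_inv e) w).
  by apply/funext => w; rewrite /= actE.
have dA i : derivable ((fun h => A h i j) \o chart_inv e) w0 v.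
  by apply: diff_derivable; have [] := C1A i j ae ew0.
have da : derivable ((fun h => a h 0 j) \o chart_inv e) w0 v.
  by apply: diff_derivable; have [] := C1a j ae ew0.
have := is_derive_affine (fun i => x 0 i) dA da => ?; rewrite derive_val !mxE.
by congr (_ + _); apply: eq_bigr => i _; rewrite !mxE.
Qed.

(** A two-sided translate that passes through the identity at [w] moves points there with the
    velocity of a generator, one [v'] serving all [x] and [j]. *)
Lemma derive_act_translation (h1 h2 : H) (f : chart R k H) w v : atlas f ->
  chart_img f w -> (h1 * chart_inv f w * h2 = 1)%g ->
  exists v', forall x j,
    'D_v (fun w' => act (h1 * chart_inv f w' * h2)%g x 0 j) w =
    (x *m C v' + b v') 0 j.
Proof.
move=> af fw fw1.
have /(_ v) [|v' v'P] := @derive_translation _ _ _ _ lieH h1 h2 f e w _ af ae fw.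
  by rewrite fw1.
exists v' => x j; rewrite -derive_act (v'P (fun h => act h x 0 j)) fw1//.
by have [] := C1act x j ae ew0.
Qed.

Lemma derivable_act_translation (h1 h2 : H) (f : chart R k H) w v x j : atlas f ->
  chart_img f w -> derivable (fun w' => act (h1 * chart_inv f w' * h2)%g x 0 j) w v.
Proof.
move=> af fw; have [g ag gw] := lie_atlas_cover lieH (h1 * chart_inv f w * h2)%g.
have gi : chart_img g (chart_map g (h1 * chart_inv f w * h2)%g).
  exact: (chart_map_fun gw).
have [d _] := C1act x j ag gi.
have dd := differentiable_comp (translation_differentiable lieH af ag fw gw) d.
apply: near_eq_derivable (diff_derivable dd).
have : \forall w' \near w, chart_dom g (h1 * chart_inv f w' * h2)%g.
  exact: (translation_continuous lieH fw (chart_dom_near gw)).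
by apply: filterS => w' gw' /=; rewrite chart_mapK ?inE.
Qed.

(** Differentiates [act (h * g * h^-1) (act h x) = act h (act g x)] in [g] at the identity. *)
Lemma tangent_conjugation h v : exists v', forall x,
  act h x *m C v' + b v' = (x *m C v + b v) *m A h.
Proof.
have hh : (h * chart_inv e w0 * h^-1 = 1)%g by rewrite inv_w0 mulg1 mulgV.
have [v' v'P] := derive_act_translation v ae ew0 hh; exists v' => x.
apply/rowP => j; rewrite -v'P [RHS]mxE.
have -> : (fun w => act (h * chart_inv e w * h^-1)%g (act h x) 0 j) =
    (fun w => \sum_i A h i j * ((fun g => act g x 0 i) \o chart_inv e) w + cst (a h 0 j) w).
  apply/funext => w; rewrite actM -[act (h^-1)%g _]actM mulVg act1 actM actE /=.
  by congr (_ + _); apply: eq_bigr => i _; rewrite mulrC.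
have da i : derivable ((fun g => act g x 0 i) \o chart_inv e) w0 v.
  by apply: diff_derivable; have [] := C1act x i ae ew0.
have := is_derive_affine (fun i => A h i j) da (derivable_cst (a h 0 j) w0 v) => ?.
rewrite derive_val derive_cst addr0; apply: eq_bigr => i _.
by rewrite derive_act mulrC.
Qed.

(** The group elements that displace every point by a vector in the kernel of [D] form a subgroup,
    so elements near the identity suffice; these are joined to it by a segment in the chart. *)
Lemma orbit_in_affine (D : 'M[R]_n) : (forall x v, (x *m C v + b v) *m D = 0) ->
  forall h x, (act h x - x) *m D = 0.
Proof.
move=> CD.
apply: (@open_subgroup_full _ _ _ _ lieH
  [set h | forall x, (act h x - x) *m D = 0]) => //; last first.
- move=> h hD x /=; have := hD (act (h^-1)%g x); rewrite -actM mulgV act1.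
  by rewrite -opprB mulNmx => /eqP; rewrite oppr_eq0 => /eqP.
- move=> g h gD hD x /=; rewrite actM -(subrKA (act h x)) [LHS]mulmxDl.
  by rewrite gD hD addr0.
have [rho /= rho0 ball_img] : exists2 rho : R, 0 < rho &
    forall w, `|w - w0| < rho -> chart_img e w.
  have /nbhs_ballP[rho /= rho0 sub] := chart_img_near ew0; exists rho => // w ww.
  by apply: sub; rewrite -ball_normE /= distrC.
have ne : \forall h \near (1%g : H), chart_dom e h /\ `|chart_map e h - w0| < rho.
  apply: filterI; first exact: chart_dom_near.
  have : {for (1%g : H), continuous (chart_map e)}.
    by apply: chart_map_continuous; rewrite inE.
  move=> /(_ (fun w => `|w - w0| < rho)); apply.
  apply/nbhs_ballP; exists rho => // w.
  by rewrite -ball_normE /= distrC.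
apply: filterS ne => h [eh hrho] x /=; apply/rowP => j; rewrite [RHS]mxE.
set w := chart_map e h; pose F w' := ((act (chart_inv e w') x) *m D) 0 j.
have FE : F = (fun w' => \sum_i D i j * ((fun g => act g x 0 i) \o chart_inv e) w' + cst 0 w').
  by apply/funext => w'; rewrite /F mxE addr0; apply: eq_bigr => i _; rewrite mulrC.
have inw : chart_inv e w = h by apply: chart_mapK; rewrite inE.
suff : F w - F w0 = 0.
  by rewrite /F inw inv_w0 act1 mulmxBl => <-; rewrite [LHS]mxE [X in _ + X]mxE.
have wt (t : R) : 0 <= t <= 1 -> chart_img e (w0 + t *: (w - w0)).
  move=> /andP[t0 t1]; apply: ball_img; rewrite addrC addKr normrZ ger0_norm//.
  by rewrite (le_lt_trans _ hrho)// ler_piMl.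
have dact (t : R) i : 0 <= t <= 1 ->
    differentiable ((fun g => act g x 0 i) \o chart_inv e) (w0 + t *: (w - w0)).
  by move=> /wt t01; have [] := C1act x i ae t01.
have [t t01|t t01] := @mean_value_line R _ F w0 (w - w0).
  rewrite FE; have -> : (fun w' => \sum_i D i j *
     ((fun g => act g x 0 i) \o chart_inv e) w' + cst 0 w') =
     \sum_i (D i j *: ((fun g => act g x 0 i) \o chart_inv e)).
    by apply/funext => y; rewrite fct_sumE addr0.
  by apply: differentiable_sum => i; apply: differentiableZ; exact: dact.
rewrite [w0 + _]addrC subrK => ->; set wt' := w0 + _; set v := w - w0.
have wtI : chart_img e wt' by exact: wt.
have hh : (1 * chart_inv e wt' * (chart_inv e wt')^-1 = 1)%g by rewrite mul1g mulgV.
have [v' v'P] := derive_act_translation v ae wtI hh.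
(* Translating on the right by the inverse of [chart_inv e wt'] turns the derivative at [wt'] into a
   generator evaluated at [act (chart_inv e wt') x], which [D] kills. *)
have -> : F = (fun w' => \sum_i D i j * ((fun w' =>
    act (1 * chart_inv e w' * (chart_inv e wt')^-1)%g (act (chart_inv e wt') x) 0 i)) w'
    + cst 0 w').
  rewrite FE; apply/funext => y; congr (_ + _); apply: eq_bigr => i _.
  by rewrite /= mul1g -actM mulgVK.
have da i : derivable (fun w' => act (1 * chart_inv e w' * (chart_inv e wt')^-1)%g
    (act (chart_inv e wt') x) 0 i) wt' v by exact: derivable_act_translation.
have := is_derive_affine (fun i => D i j) da (derivable_cst 0 wt' v) => ?.
rewrite derive_val derive_cst addr0.
have /(congr1 (fun M : 'rV[R]_n => M 0 j)) := CD (act (chart_inv e wt') x) v'.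
rewrite [LHS]mxE [RHS]mxE => D0; rewrite -[RHS]D0; apply: eq_bigr => i _.
by rewrite v'P mulrC.
Qed.

(** The kernel of [D] is the range of [b]. It contains all values of generators, hence all
    displacements, so it is an invariant linear subspace and thus everything. Given [b v = y],
    subtracting from [v] some [u] with [C u = 0] and [b u = x *m C v] gives the value [y] at [x]. *)
Lemma tangent_full x y : exists v, x *m C v + b v = y.
Proof.
pose C' : {linear 'rV[R]_k -> 'M[R]_n} :=
  HB.pack C (GRing.isLinear.Build _ _ _ _ C tangent_linear_linear).
pose b' : {linear 'rV[R]_k -> 'rV[R]_n} :=
  HB.pack b (GRing.isLinear.Build _ _ _ _ b tangent_translation_linear).
have act_inv h z : act h (act (h^-1)%g z) = z by rewrite -actM mulgV act1.
have Cb := @linear_part_in_translations R k n H A a c (fun h => h^-1)%g C' b'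
  simA c_inv act_inv tangent_conjugation no_invariant_affine.
pose D := cokermx (lin1_mx b').
have bD v : b v *m D = 0.
  by rewrite -[b v](mul_rV_lin1 b') -mulmxA mulmx_coker mulmx0.
have CD z v : (z *m C v + b v) *m D = 0.
  by have [u _ zu] := Cb v z; rewrite mulmxDl bD addr0 [z *m _]zu bD.
have Dfull : lker (linfun (mulmxr D : 'rV[R]_n -> 'rV[R]_n)) = fullv.
  apply: (no_invariant_affine (x0 := 0)) => h z; rewrite !subr0 !memv_ker !lfunE /=.
  by move=> /eqP zD; rewrite -[act h z](subrK z) mulmxDl (orbit_in_affine CD) add0r zD.
have /submxP[v yv] : (y <= lin1_mx b')%MS.
  by rewrite submxE; have := memvf y; rewrite -Dfull memv_ker lfunE.
have [u Cu xu] := Cb v x; exists (v - u).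
have CB := linearB C' v u; have bB := linearB b' v u.
rewrite [C _]CB [b _]bB Cu subr0 [x *m _]xu addrC subrK yv.
by rewrite mul_rV_lin1.
Qed.

(** Generators taking the standard basis as values at [x] make the derivative of the orbit map the
    identity at [w0], and close to it nearby by continuity. *)
Lemma orbit_near (x : 'rV[R]_n) : exists2 d : R, 0 < d & forall y : 'rV[R]_n,
  (forall j, `|y 0 j - x 0 j| < d) -> exists h, act h x = y.
Proof.
have [s sP] : exists s : 'I_n -> 'rV[R]_k,
    forall i, x *m C (s i) + b (s i) = delta_mx 0 i.
  by have /choice[s sP] := fun i => tangent_full x (delta_mx 0 i); exists s.
pose f j := (fun h => act h x 0 j) \o chart_inv e.
pose eps : R := (2 * n.+1%:R)^-1.
have eps0 : 0 < eps by rewrite invr_gt0 mulr_gt0 ?ltr0n.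
have nearw : \forall w \near w0, chart_img e w /\ forall ij : 'I_n * 'I_n,
    `|'D_(s ij.1) (f ij.2) w - (ij.1 == ij.2)%:R| <= eps.
  apply: filterI; first exact: chart_img_near.
  apply: (@filter_forall _ _ (fun (ij : 'I_n * 'I_n) w =>
    `|'D_(s ij.1) (f ij.2) w - (ij.1 == ij.2)%:R| <= eps) (nbhs w0)) => -[i j] /=.
  have [_ /(_ (s i)) cD] := C1act x j ae ew0.
  have Dw0 : 'D_(s i) (f j) w0 = (i == j)%:R.
    by rewrite derive_act sP mxE eqxx eq_sym.
  move/cvgrPdist_le : cD => /(_ eps eps0).
  by apply: filterS => w; rewrite -[X in `|X - _|]/('D_(s i) (f j) w0) Dw0 distrC.
have /nbhs_ballP[rho /= rho0 sub] := nearw.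
have ballP w : `|w - w0| < rho -> chart_img e w /\ forall ij : 'I_n * 'I_n,
    `|'D_(s ij.1) (f ij.2) w - (ij.1 == ij.2)%:R| <= eps.
  by move=> ww; apply: sub; rewrite -ball_normE /= distrC.
have df w : `|w - w0| < rho -> forall j, differentiable (f j) w.
  by move=> /ballP[ew _] j; have [] := C1act x j ae ew.
have Df w : `|w - w0| < rho -> forall i j, `|'D_(s i) (f j) w - (i == j)%:R| <= eps.
  by move=> /ballP[_ wD] i j; exact: (wD (i, j)).
have [d d0 dP] : exists2 d : R, 0 < d & forall z : 'I_n -> R,
    (forall j, `|z j - f j w0| < d) ->
    exists2 w, `|w - w0| < rho & forall j, f j w = z j.
  exists (rho / (1 + \sum_i `|s i|) / (2 * n.+2%:R)).
    rewrite !divr_gt0 ?mulr_gt0 ?ltr0n// ltr_pwDl// sumr_ge0//.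
  exact: local_surjectivity rho0 df Df.
exists d => // y yx; have [j|w _ wy] := dP (fun j => y 0 j).
  by rewrite /f /= inv_w0 act1.
by exists (chart_inv e w); apply/rowP => j; rewrite -wy.
Qed.

(** Orbits are open, so the parameters at which the line from [x] to [y] meets the orbit of [x] form
    an open and closed subset of the reals. *)
Lemma affine_action_transitive (x y : 'rV[R]_n) : exists h, act h x = y.
Proof.
pose l (t : R) := x + t *: (y - x).
pose B := [set t : R | exists h, act h x = l t].
have nl (t : R) (d : R) : 0 < d -> \forall t' \near t, forall j, `|l t' 0 j - l t 0 j| < d.
  move=> d0; apply: (@filter_forall _ _ (fun j t' => `|l t' 0 j - l t 0 j| < d) (nbhs t)) => j.
  have : (fun t' => l t' 0 j) @ t --> l t 0 j.
    have lE t' : l t' 0 j = x 0 j + t' * (y - x) 0 j by rewrite !mxE.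
    rewrite lE; under eq_fun do rewrite lE.
    by apply: cvgD; [exact: cvg_cst|apply: cvgMr_tmp; exact: cvg_id].
  by move/cvgrPdist_lt => /(_ d d0); apply: filterS => t'; rewrite distrC.
suff BT : B = setT.
  have [h hy] : B 1 by rewrite BT.
  by exists h; rewrite hy /l scale1r addrC subrK.
have cR : connected [set: R] by apply/connected_intervalP.
apply: cR; first by exists 0, 1%g; rewrite act1 /l scale0r addr0.
- exists B; last by rewrite setTI.
  rewrite openE => t [h ht]; have [d d0 dP] := orbit_near (l t).
  apply: filterS (nl t d d0) => t' /dP[g gt]; exists (g * h)%g.
  by rewrite actM ht.
- exists B; last by rewrite setTI.
  rewrite -openC openE => t nBt; have [d d0 dP] := orbit_near (l t).
  apply: filterS (nl t d d0) => t' /dP[g gt] [h ht]; apply: nBt.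
  by exists (g^-1 * h)%g; rewrite actM ht -gt -actM mulVg act1.
Qed.

End TransitiveAffineActions.

(** * Minkowski spaces *)

Lemma form_sub_scale (R : realType) (V : lmodType R) (eta : {symmetric V}) (v u : V) t :
  eta (v - t *: u) (v - t *: u) = eta v v - 2 * t * eta v u + t ^+ 2 * eta u u.
Proof.
rewrite linearBl !linearBr !linearZl_LR !linearZr_LR /= (sformC eta u v) /GRing.scale /=; ring.
Qed.

Section MinkowskiSpace.
Variables (R : realType) (n : nat) (V : vectType R) (eta : {symmetric V}) (p : V).
Hypotheses (heta : has_signature eta 1 n.+1) (hp0 : p != 0) (hp : eta p p = 0).

(** Subtracting from [v] the multiple of [p] with the same timelike coordinate does not change
    [eta v v] and leaves a vector with only spacelike coordinates, whose square is a sum of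
    squares. *)
Lemma isotropic_orthogonal (v : V) : eta v p = 0 ->
  0 <= eta v v /\ (eta v v = 0 -> v \in <[p]>%VS).
Proof.
have [b bb bE] := heta; move=> vp.
pose x (w : V) i := coord b i w.
have vE w : w = \sum_i x w i *: b`_i by exact: (coord_basis bb (memvf w)).
have etaE u w : eta u w = - (x u ord0 * x w ord0) +
    \sum_(i < n.+1) x u (lift ord0 i) * x w (lift ord0 i).
  have -> : eta u w = \sum_i x u i * x w i * eta b`_i b`_i.
    rewrite {1}(vE u) linear_sumlz; apply: eq_bigr => i _.
    rewrite linearZl_LR /= {1}(vE w) linear_sumr -mulrA; congr (_ * _).
    rewrite (bigD1 i)//= big1 ?addr0 => [|j ji]; first by rewrite linearZr_LR.
    by rewrite linearZr_LR /= bE eq_sym (negPf ji) mulr0.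
  rewrite big_ord_recl (bE ord0 ord0) eqxx /= mulrN1; congr (_ + _).
  by apply: eq_bigr => i _; rewrite (bE (lift ord0 i) (lift ord0 i)) eqxx /= mulr1.
have p0 : x p ord0 != 0.
  apply/eqP => p0; have := hp; rewrite etaE p0 mul0r oppr0 add0r => /eqP.
  rewrite psumr_eq0 => [/allP p0'|i _]; last by rewrite -expr2 sqr_ge0.
  move/eqP: hp0; apply; rewrite (vE p) big1 // => i _.
  have [j ->|->] := unliftP ord0 i; last by rewrite p0 scale0r.
  have := p0' j (mem_index_enum j); rewrite mulf_eq0 orbb => /eqP ->.
  by rewrite scale0r.
pose t := x v ord0 / x p ord0; pose w := v - t *: p.
have w0 : x w ord0 = 0 by rewrite /x linearB linearZ /= mulfVK// subrr.
have ww : eta w w = eta v v.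
  by rewrite form_sub_scale vp hp !mulr0 subr0 addr0.
have wE : eta v v = \sum_(i < n.+1) x w (lift ord0 i) ^+ 2.
  by rewrite -ww etaE w0 mul0r oppr0 add0r.
split; first by rewrite wE; apply: sumr_ge0 => i _; exact: sqr_ge0.
rewrite wE => /eqP; rewrite psumr_eq0 => [/allP wi|i _]; last exact: sqr_ge0.
suff : w = 0 by move/eqP; rewrite subr_eq0 => /eqP ->; rewrite memvZ ?memv_line.
rewrite (vE w) big1 // => i _.
have [j ->|->] := unliftP ord0 i; last by rewrite w0 scale0r.
by have := wi j (mem_index_enum j); rewrite sqrf_eq0 => /eqP ->; rewrite scale0r.
Qed.

(** [q] is a vector of product 1 with [p], made isotropic by subtracting a multiple of [p]; the
    [s i] come from Gram-Schmidt on the orthogonal of [p] and [q]. *)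
Lemma witt_basis : exists (q : V) (m : nat) (s : 'I_m -> V),
  [/\ eta q q = 0, eta p q = 1, forall i, eta (s i) p = 0 /\ eta (s i) q = 0,
      forall i j, eta (s i) (s j) = (i == j)%:R &
      forall v, v = eta v q *: p + eta v p *: q + \sum_i eta v (s i) *: s i].
Proof.
(* Otherwise the timelike basis vector would be orthogonal to [p], where the form is nonnegative. *)
have [u pu] : exists u, eta p u != 0.
  apply: contrapT => np.
  have p0 u : eta u p = 0.
    by apply: contrapT => /eqP up; apply: np; exists u; rewrite sformC.
  have [b bb bE] := heta.
  have := isotropic_orthogonal (p0 b`_0).
  by rewrite (bE ord0 ord0) eqxx /= oppr_ge0 ler10 => -[].
have [u' pu'] : exists u', eta p u' = 1.
  by exists ((eta p u)^-1 *: u); rewrite linearZr_LR /= mulVf.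
pose q := u' - (eta u' u' / 2) *: p.
have pq : eta p q = 1 by rewrite /q linearBr linearZr_LR /= hp mulr0 subr0.
have qq : eta q q = 0.
  rewrite /q form_sub_scale hp (sformC eta u') pu' mulr0 addr0 mulr1 mulrC.
  by rewrite divfK ?subrr ?pnatr_eq0.
have [|m [s [sW sO sP]]] :=
    @gram_schmidt R V eta (orthov eta <[p]> :&: orthov eta <[q]>)%VS.
  move=> w; rewrite memv_cap !mem_orthov1 => /andP[/eqP wp _].
  by have [] := isotropic_orthogonal wp.
have sW' i : eta (s i) p = 0 /\ eta (s i) q = 0.
  by have := sW i; rewrite memv_cap !mem_orthov1 => /andP[/eqP ? /eqP ?].
exists q, m, s; split => // v.
pose w := v - eta v q *: p - eta v p *: q.
have wW : w \in (orthov eta <[p]> :&: orthov eta <[q]>)%VS.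
  rewrite memv_cap !mem_orthov1 /w !linearBl !linearZl_LR /= hp pq qq (sformC eta q) pq.
  by rewrite !mulr0 !mulr1 !subr0 !subrr eqxx.
have ws i : eta w (s i) = eta v (s i).
  have [sp sq] := sW' i.
  by rewrite /w !linearBl !linearZl_LR /= !(sformC eta _ (s i)) sp sq !mulr0 !subr0.
have := sP _ wW; under eq_bigr do rewrite ws; set r := w - _ => rr.
have rW : r \in (orthov eta <[p]> :&: orthov eta <[q]>)%VS.
  by rewrite rpredB// rpred_sum// => i _; rewrite rpredZ.
have := rW; rewrite memv_cap !mem_orthov1 => /andP[/eqP rp /eqP rq].
(* Isotropic and orthogonal to [p], the remainder is a multiple of [p]; orthogonality to [q] makes
   it zero. *)
have [_ /(_ rr)/vlineP[t rt]] := isotropic_orthogonal rp.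
have t0 : t = 0 by move: rq; rewrite rt linearZl_LR /= pq mulr1.
have : r = 0 by rewrite rt t0 scale0r.
move=> /eqP; rewrite subr_eq0 => /eqP <-.
by rewrite /w -(addrA v) -opprD [RHS]addrC subrK.
Qed.

Lemma isotropic_not_orthogonal (v : V) : eta v v = 0 -> v \notin <[p]>%VS -> eta v p != 0.
Proof.
move=> vv; apply: contraNneq => vp.
by have [_] := isotropic_orthogonal vp; apply.
Qed.

Local Notation X := (isotropic_lines eta `\ <[p]>%VS).

Lemma isotropic_line_vector L : X L ->
  exists u, [/\ L = <[u]>%VS, eta u u = 0 & eta u p = 1].
Proof.
move=> [[dL isoL] Lp].
have L0 : L != 0%VS by rewrite -dimv_eq0 dL.
have LE : L = <[vpick L]>%VS.
  apply/esym/eqP; rewrite eqEdim dL dim_vline vpick0 L0 andbT -memvE.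
  exact: memv_pick.
have vv : eta (vpick L) (vpick L) = 0 by apply: isoL; exact: memv_pick.
have vp : eta (vpick L) p != 0.
  apply: isotropic_not_orthogonal => //; apply/negP => vp; apply: Lp.
  apply/eqP; rewrite /= eqEdim [X in (X <= _)%VS]LE -memvE vp dL dim_vline.
  by case: (p != 0).
exists ((eta (vpick L) p)^-1 *: vpick L); split.
- apply/eqP; rewrite {1}LE eqEdim -memvE !dim_vline scaler_eq0 invr_eq0.
  rewrite (negPf vp) vpick0 L0 andbT; apply/vlineP; exists (eta (vpick L) p).
  by rewrite scalerA mulfV// scale1r.
- by rewrite linearZl_LR linearZr_LR /= vv !mulr0.
- by rewrite linearZl_LR /= mulVf.
Qed.

Lemma isotropic_vector_line u : eta u u = 0 -> eta u p != 0 -> X <[u]>%VS.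
Proof.
move=> uu up; split.
  split; last by move=> _ /vlineP[t ->]; rewrite linearZl_LR linearZr_LR /= uu !mulr0.
  rewrite dim_vline; suff -> : u != 0 by [].
  by apply: contraNneq up => ->; rewrite linear0l.
move=> uE; have : u \in <[p]>%VS by rewrite -uE memv_line.
by move=> /vlineP[t ut]; move: up; rewrite ut linearZl_LR /= hp mulr0 eqxx.
Qed.

(** A vector not orthogonal to [p] is isotropic up to a multiple of [p]; a vector [v] orthogonal to
    [p] is the difference of [v + q] and [q], which are not. *)
Lemma isotropic_lines_span (W : {vspace V}) : p \in W ->
  (forall L, X L -> (L <= W)%VS) -> W = fullv.
Proof.
move=> pW XW; have [q [m [s [qq pq _ _ _]]]] := witt_basis.
have qp : eta q p = 1 by rewrite sformC.
have WP v : eta v p != 0 -> v \in W.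
  move=> vp; pose t := eta v v / (2 * eta v p).
  have : v - t *: p \in W.
    rewrite memvE; apply/XW/isotropic_vector_line.
      have te : t * eta v p = eta v v / 2 by rewrite /t invfM mulrA mulfVK.
      by rewrite form_sub_scale hp -mulrA te mulr0 addr0 mulrC divfK ?subrr ?pnatr_eq0.
    by rewrite linearBl linearZl_LR /= hp mulr0 subr0.
  by move=> /(rpredD (memvZ t pW)); rewrite addrC subrK.
apply/eqP; rewrite eqEsubv subvf; apply/subvP => v _.
have [vp|] := eqVneq (eta v p) 0; last exact: WP.
rewrite -[v](addrK q) rpredB// WP// ?linearDl /= ?vp ?qp ?add0r ?oner_neq0//.
Qed.

(** [phi] pairs a vector with a basis of [U]. Nondegeneracy makes it injective on [U], hence by
    dimension [U] already maps onto all values. *)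
Lemma nondegenerate_decomposition (U : {vspace V}) : nondegenerate_on eta U ->
  forall v, exists2 u, u \in U & {in U, forall w, eta (v - u) w = 0}.
Proof.
move=> ndU v; pose phi v := \row_(j < \dim U) eta v (vbasis U)`_j.
have phil : linear phi.
  by move=> t x y; apply/rowP => j; rewrite !mxE linearPl.
pose phi' : {linear V -> 'rV[R]_(\dim U)} :=
  HB.pack phi (GRing.isLinear.Build _ _ _ _ phi phil).
have phi0 w : phi w = 0 -> {in U, forall z, eta w z = 0}.
  move=> w0 z zU; rewrite (coord_vbasis zU) linear_sumr big1 // => j _.
  have /rowP/(_ j) := w0; rewrite !mxE => wj.
  by rewrite linearZr_LR /= wj mulr0.
have ker0 : (U :&: lker (linfun phi') = 0)%VS.
  apply/eqP; rewrite -subv0; apply/subvP => w; rewrite memv_cap memv_ker lfunE.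
  by move=> /andP[wU /eqP w0]; rewrite memv0; apply/eqP/ndU => //; exact: phi0.
have : phi v \in (linfun phi' @: U)%VS.
  suff -> : (linfun phi' @: U)%VS = fullv by exact: memvf.
  by apply/eqP; rewrite eqEdim subvf (limg_dim_eq ker0) dimvf /dim /= mul1n.
move=> /memv_imgP[u uU]; rewrite lfunE /= => vu; exists u => //; apply: phi0.
by rewrite -[LHS]/(phi' (v - u)) linearB /= vu subrr.
Qed.

End MinkowskiSpace.

(** * Groups preserving an isotropic line: from transitivity to weak irreducibility *)

Section LineStabilizer.
Variables (R : realType) (n : nat) (V : vectType R) (eta : {symmetric V}) (p : V).
Hypotheses (heta : has_signature eta 1 n.+1) (hp0 : p != 0) (hp : eta p p = 0).
Variables (H : groupType) (f : H -> 'End(V)).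
Hypotheses (f1 : f 1%g = \1%VF) (fM : forall x y, f (x * y)%g = (f x \o f y)%VF).
Hypothesis fSO : forall h, SO_line eta p (f h).

Local Notation X := (isotropic_lines eta `\ <[p]>%VS).

Let fV h v : f h (f (h^-1)%g v) = v.
Proof. by rewrite -[LHS]comp_lfunE -fM mulgV f1 id_lfunE. Qed.

Let f_eta h u v : eta (f h u) (f h v) = eta u v.
Proof. by have [[fe _] _] := fSO h. Qed.

Lemma SO_line_eigenvector h : exists t, f h p = t *: p.
Proof.
have [_ fp] := fSO h; apply/vlineP.
by rewrite -fp memv_img ?memv_line.
Qed.

Lemma invariant_orthov (U : {vspace V}) : (forall h, (f h @: U <= U)%VS) ->
  forall h, (f h @: orthov eta U <= orthov eta U)%VS.
Proof.
move=> fU h; apply/subvP => _ /memv_imgP[v /mem_orthovP vU ->].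
apply/mem_orthovP => w wU; rewrite -(fV h w) f_eta; apply: vU.
by have /subvP := fU (h^-1)%g; apply; exact: memv_img.
Qed.

(** [W] contains the isotropic line of [u - t *: p], hence its images, which are all the lines of
    [X]; together with [p] these span [V]. *)
Lemma transitive_invariant_full (W : {vspace V}) :
  transitive_on_lines (range f) X -> (forall h, (f h @: W <= W)%VS) ->
  p \in W -> (exists2 u, u \in W & eta u p != 0) -> W = fullv.
Proof.
move=> transX fW pW [u uW up].
pose t := eta u u / (2 * eta u p).
have te : t * eta u p = eta u u / 2 by rewrite /t invfM mulrA mulfVK.
have lX : X <[u - t *: p]>%VS.
  apply: isotropic_vector_line => //.
    by rewrite form_sub_scale hp -mulrA te mulr0 addr0 mulrC divfK ?subrr ?pnatr_eq0.
  by rewrite linearBl linearZl_LR /= hp mulr0 subr0.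
apply: (isotropic_lines_span heta hp0 hp pW) => L XL.
have [_ [h _ <-] <-] := transX _ _ lX XL.
apply: subv_trans (fW h); apply: limgS; rewrite -memvE.
by rewrite rpredB// memvZ.
Qed.

(** In dimension 2 only one isotropic line differs from [<[p]>], and transitivity says nothing. The
    bound enters at the end: the plane of two fixed isotropic lines must be proper. *)
Lemma transitive_weakly_irreducible : (2 < \dim {:V})%N ->
  transitive_on_lines (range f) X -> weakly_irreducible eta (range f).
Proof.
move=> dV transX [U [U0 UT ndU fU']].
have fU h : (f h @: U <= U)%VS by apply: fU'; exists h.
have dec := nondegenerate_decomposition ndU.
have [q [m [s [_ pq _ _ _]]]] := witt_basis heta hp0 hp.
have [pU pUU pDP] := dec p.
have [pD [pDE pDO]] : exists pD, p = pU + pD /\ pD \in orthov eta U.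
  by exists (p - pU); split; [rewrite addrC subrK|exact/mem_orthovP].
have Ocap w : w \in U -> w \in orthov eta U -> w = 0.
  by move=> wU /mem_orthovP; exact: ndU.
have [pD0|pD0] := eqVneq pD 0.
  have pU' : p \in U by rewrite pDE pD0 addr0.
  move/eqP: UT; apply; apply: transitive_invariant_full => //.
  apply: contrapT => nu; move/eqP: hp0; apply; apply: ndU => // u uU.
  by apply: contrapT => /eqP up; apply: nu; exists u => //; rewrite sformC.
have [pU0|pU0] := eqVneq pU 0.
  have pO : p \in orthov eta U by rewrite pDE pU0 add0r.
  have OT : orthov eta U = fullv.
    apply: transitive_invariant_full => //; first exact: invariant_orthov.
    have [qU qUU qDP] := dec q; exists (q - qU); first exact/mem_orthovP.
    rewrite linearBl /= (sformC eta q) pq (sformC eta qU).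
    by have /mem_orthovP -> := pO; rewrite // subr0 oner_neq0.
  move/eqP: U0; apply; apply/eqP; rewrite -subv0; apply/subvP => u uU.
  by rewrite memv0 (Ocap u)// OT memvf.
have pUD : eta pU pD = 0 by rewrite sformC; move/mem_orthovP: pDO; apply.
(* [f h] respects the splitting of [V] into [U] and its orthogonal, so both components of [p] are
   eigenvectors with the eigenvalue of [p]. *)
have fpU h : exists t, f h pU = t *: pU /\ f h pD = t *: pD.
  have [t fp] := SO_line_eigenvector h; exists t.
  have E : f h pU - t *: pU = t *: pD - f h pD.
    apply/eqP; rewrite subr_eq addrAC eq_sym subr_eq eq_sym -scalerDr -linearD /=.
    by rewrite -[pD + pU]addrC -pDE fp.
  have E0 : f h pU - t *: pU = 0.
    apply: Ocap; first by rewrite rpredB ?memvZ// (subvP (fU h)) ?memv_img.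
    rewrite E rpredB ?memvZ// (subvP (invariant_orthov fU h)) ?memv_img//.
  split; apply/eqP; rewrite -subr_eq0 ?E0//.
  by rewrite -opprB -E E0 oppr0.
(* The reflection of [p] in [U], again isotropic and an eigenvector; its line is a second one
   because both components are nonzero. *)
pose p' := pU - pD.
have p'p : p' \notin <[p]>%VS.
  apply/negP => /vlineP[t p't].
  have E : (1 - t) *: pU = (1 + t) *: pD.
    apply/eqP; rewrite -subr_eq0 scalerBl scalerDl !scale1r opprD addrACA -opprD.
    by rewrite -scalerDr -pDE -[pU - pD]/p' p't subrr.
  have E0 : (1 - t) *: pU = 0.
    by apply: Ocap; [rewrite memvZ|rewrite E memvZ].
  move: (E0) => /eqP; rewrite scaler_eq0 (negPf pU0) orbF subr_eq0 => /eqP t1.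
  move: E; rewrite E0 => /esym/eqP; rewrite scaler_eq0 (negPf pD0) orbF -t1.
  by rewrite -mulr2n pnatr_eq0.
have p'iso : eta p' p' = 0.
  have := hp; rewrite {1 2}pDE /p' !linearBl !linearBr !linearDl !linearDr /=.
  by rewrite (sformC eta pD pU) pUD; lra.
have WT : (<[p]> + <[p']>)%VS = fullv.
  apply: transitive_invariant_full => //.
  - move=> h; have [t [fU1 fD1]] := fpU h; have [t' fp] := SO_line_eigenvector h.
    rewrite limgD !limg_line fp /p' linearB /= fU1 fD1 -scalerBr.
    by apply: addvS; rewrite -memvE memvZ ?memv_line.
  - by rewrite (subvP (addvSl _ _)) ?memv_line.
  - exists p'; first by rewrite (subvP (addvSr _ _)) ?memv_line.
    exact: (isotropic_not_orthogonal heta hp0 hp).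
move: dV; rewrite -WT ltnNge => /negP; apply.
apply: (leq_trans (dimv_add_leqif _ _)); rewrite !dim_vline.
by case: (p != 0); case: (p' != 0).
Qed.

(** * The similarity action in the affine chart: from weak irreducibility to transitivity *)

Variables (q : V) (m : nat) (s : 'I_m -> V).
Hypotheses (qq : eta q q = 0) (pq : eta p q = 1).
Hypothesis sp : forall i, eta (s i) p = 0.
Hypothesis sq : forall i, eta (s i) q = 0.
Hypothesis ss : forall i j, eta (s i) (s j) = (i == j)%:R.
Hypothesis wittE : forall v,
  v = eta v q *: p + eta v p *: q + \sum_i eta v (s i) *: s i.

(* The chart sends the line of an isotropic [u] with [eta u p = 1] to
   [screen_coord u]. Through it [h] acts as
   [x |-> x *m similarity_linear h + similarity_translation h]; the factor
   [eigenvalue_at h] restores the normalisation, since [f h] divides [eta u p] by it. *)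
Definition eigenvalue_at h : R := eta (f h p) q.

Definition similarity_linear h : 'M[R]_m :=
  \matrix_(i, j) (eigenvalue_at h * eta (f h (s i)) (s j)).

Definition similarity_translation h : 'rV[R]_m :=
  \row_j (eigenvalue_at h * eta (f h q) (s j)).

Definition screen_coord (v : V) : 'rV[R]_m := \row_j eta v (s j).

Local Notation lam := eigenvalue_at.
Local Notation A := similarity_linear.
Local Notation a := similarity_translation.
Local Notation act h x := (x *m A h + a h).
(** Equals the isotropic vector with coordinate [x] up to a multiple of [p], which [screen_coord]
    ignores and each [f h] sends to a multiple of [p]. *)
Let pt (x : 'rV[R]_m) : V := q + \sum_i x 0 i *: s i.

Let fp h : f h p = lam h *: p.
Proof.
have [t fpt] := SO_line_eigenvector h.
by rewrite /eigenvalue_at fpt linearZl_LR /= pq mulr1.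
Qed.

Let lamM g h : lam (g * h)%g = lam g * lam h.
Proof.
by rewrite {1}/eigenvalue_at fM comp_lfunE fp linearZ linearZl_LR /= mulrC.
Qed.

Let lam1 : lam 1%g = 1.
Proof. by rewrite /eigenvalue_at f1 id_lfunE. Qed.

Lemma eigenvalue_atV h : lam h * lam (h^-1)%g = 1.
Proof. by rewrite -lamM mulgV lam1. Qed.

Let lam0 h : lam h != 0.
Proof.
by apply/eqP => l0; have := eigenvalue_atV h; rewrite l0 mul0r => /eqP; rewrite eq_sym oner_eq0.
Qed.

Let f_eta_p h v : eta (f h v) p = (lam h)^-1 * eta v p.
Proof.
apply: (mulfI (lam0 h)); rewrite mulrA mulfV// mul1r.
by rewrite -(f_eta h v p) fp linearZr_LR.
Qed.

Let screen_linear t u v : screen_coord (t *: u + v) = t *: screen_coord u + screen_coord v.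
Proof. by apply/rowP => j; rewrite !mxE linearPl. Qed.

Let screen_coordZ t u : screen_coord (t *: u) = t *: screen_coord u.
Proof. by apply/rowP => j; rewrite !mxE linearZl_LR. Qed.

Let screen_p : screen_coord p = 0.
Proof. by apply/rowP => j; rewrite !mxE sformC sp. Qed.

Let screen_pt x : screen_coord (pt x) = x.
Proof.
apply/rowP => j; rewrite mxE linearDl /= (sformC eta q) sq add0r linear_sumlz.
rewrite (bigD1 j)//= big1 => [|i ij]; last by rewrite linearZl_LR /= ss (negPf ij) mulr0.
by rewrite linearZl_LR /= ss eqxx mulr1 addr0.
Qed.

Let pt_p x : eta (pt x) p = 1.
Proof.
rewrite linearDl /= (sformC eta q) pq linear_sumlz big1 ?addr0// => i _.
by rewrite linearZl_LR /= sp mulr0.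
Qed.

Let screen_f h v :
  screen_coord (f h v) = (lam h)^-1 *: (screen_coord v *m A h + eta v p *: a h).
Proof.
apply: (scalerI (lam0 h)); rewrite scalerA mulfV// scale1r.
apply/rowP => j; rewrite !mxE {1}(wittE v) !linearD !linearZ /= fp !linearDl /=.
rewrite !linearZl_LR /= (sformC eta p) sp !mulr0 add0r mulrDr mulrCA addrC.
congr (_ + _); rewrite linear_sum linear_sumlz mulr_sumr; apply: eq_bigr => i _.
by rewrite linearZ linearZl_LR /= !mxE mulrCA.
Qed.

Let actE h x : act h x = lam h *: screen_coord (f h (pt x)).
Proof. by rewrite screen_f screen_pt pt_p scale1r scalerA mulfV// scale1r. Qed.

Lemma similarity_act1 x : act 1%g x = x.
Proof. by rewrite actE lam1 scale1r f1 id_lfunE screen_pt. Qed.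

Lemma similarity_actM g h x : act (g * h)%g x = act g (act h x).
Proof.
rewrite actE fM comp_lfunE screen_f lamM f_eta_p pt_p mulr1.
rewrite scalerA mulrAC mulfV// mul1r scalerDr scalerA mulfV// scale1r.
by rewrite scalemxAl -actE.
Qed.

Let eta_screen u v : eta u p = 0 -> eta v p = 0 ->
  eta u v = frob (screen_coord u) (screen_coord v).
Proof.
move=> up vp; rewrite frobE big_ord1 {1}(wittE v) !linearDr !linearZr_LR /= up vp.
rewrite mulr0 add0r mul0r add0r linear_sumr; apply: eq_bigr => i _.
by rewrite linearZr_LR /= !mxE mulrC.
Qed.

(** The [f h (s i)] are orthonormal and orthogonal to [p], so their screen coordinates, which are
    the rows of [A h] divided by the eigenvalue, are orthonormal too. *)
Lemma similarity_linear_conformal h : A h *m (A h)^T = (lam h ^+ 2)%:M.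
Proof.
apply/matrixP => i j; rewrite !mxE.
have fs l : eta (f h (s l)) p = 0 by rewrite f_eta_p sp mulr0.
have : eta (f h (s i)) (f h (s j)) = (i == j)%:R by rewrite f_eta ss.
rewrite eta_screen// frobE big_ord1 => E; rewrite -mulr_natr -E mulr_sumr.
by apply: eq_bigr => l _; rewrite !mxE; ring.
Qed.

(* [U] contains [p] and is not orthogonal to it, and a vector of the radical of [U]
   is isotropic and orthogonal to [p], hence in the line of [p]. *)
Lemma affine_weakly_irreducible : weakly_irreducible eta (range f) ->
  forall (W : {vspace 'rV[R]_m}) x0,
  (forall h x, x - x0 \in W -> act h x - x0 \in W) -> W = fullv.
Proof.
move=> wi W x0 Wact.
have Ll : linear (fun v : V => screen_coord v - eta v p *: x0).
  move=> t u v; rewrite screen_linear linearPl /= scalerDl scalerBr scalerA.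
  by rewrite opprD addrACA.
pose L : {linear V -> 'rV[R]_m} := HB.pack (fun v : V => screen_coord v - eta v p *: x0)
  (GRing.isLinear.Build _ _ _ _ _ Ll).
(* The span of [p] and of the lifts by [pt] of the points of [x0 + W]. *)
pose U := (linfun L @^-1: W)%VS.
have memU v : (v \in U) = (screen_coord v - eta v p *: x0 \in W).
  by rewrite -memv_preim lfunE.
have pU : p \in U by rewrite memU screen_p hp scale0r subrr mem0v.
have x0U : pt x0 \in U by rewrite memU screen_pt pt_p scale1r subrr mem0v.
suff UT : U = fullv.
  apply/eqP; rewrite eqEsubv subvf; apply/subvP => y _.
  have := memvf (pt y - q); rewrite -UT memU linearBl /= pt_p (sformC eta q) pq.
  rewrite subrr scale0r subr0 -scaleN1r [_ + _]addrC screen_linear screen_pt.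
  suff -> : screen_coord q = 0 by rewrite scaler0 add0r.
  by apply/rowP => j; rewrite !mxE sformC sq.
apply: contrapT => /eqP UT; apply: wi; exists U; split => //.
- by apply: contraNneq hp0 => U0; rewrite -memv0 -U0.
- move=> u uU uO; have up : eta u p = 0 by apply: uO.
  have [_ /(_ (uO u uU))/vlineP[t ut]] := isotropic_orthogonal heta hp0 hp up.
  have := uO _ x0U; rewrite ut linearZl_LR /= sformC pt_p mulr1 => ->.
  by rewrite scale0r.
- move=> _ [h _ <-]; apply/subvP => _ /memv_imgP[v vU ->].
  rewrite memU screen_f f_eta_p -scalerA -scalerBr memvZ//.
  move: vU; rewrite memU; set y := _ - _ => yW.
  have -> : screen_coord v = y + eta v p *: x0 by rewrite subrK.
  have W0 : act h x0 - x0 \in W by apply: Wact; rewrite subrr mem0v.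
  have W1 : act h (y + x0) - x0 \in W by apply: Wact; rewrite addrK.
  (* The linear part [y *m A h] is the difference of two vectors that invariance puts in [W]. *)
  have -> : (y + eta v p *: x0) *m A h + eta v p *: a h - eta v p *: x0 =
     (act h (y + x0) - x0) - (act h x0 - x0) + eta v p *: (act h x0 - x0).
    rewrite !mulmxDl -scalemxAl; apply/rowP => j; rewrite !mxE; ring.
  by apply: rpredD; [exact: rpredB|exact: memvZ].
Qed.

(** Isotropy determines the remaining coefficient [eta w q] as minus half the square of the screen
    coordinates: this is inverse stereographic projection. *)
Lemma isotropic_screen_inj u v : eta u u = 0 -> eta v v = 0 ->
  eta u p = 1 -> eta v p = 1 -> screen_coord u = screen_coord v -> u = v.
Proof.
move=> uu vv up vp uv.
have E w : eta w w = 0 -> eta w p = 1 ->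
    eta w q = - frob (screen_coord w) (screen_coord w) / 2.
  move=> ww wp; have w0 : eta (w - q) p = 0.
    by rewrite linearBl /= wp (sformC eta q) pq subrr.
  have := eta_screen w0 w0.
  have -> : screen_coord (w - q) = screen_coord w.
    apply/rowP => j; rewrite !mxE linearBl /= (sformC eta q) sq subr0 //.
  rewrite linearBl !linearBr /= ww qq (sformC eta q) => <-.
  by field.
rewrite (wittE u) (wittE v) (E u)// (E v)// up vp uv.
congr (_ + _); apply: eq_bigr => i _.
by have /rowP/(_ i) := uv; rewrite !mxE => ->.
Qed.

Lemma affine_transitive_lines : (forall x y, exists h, act h x = y) ->
  transitive_on_lines (range f) X.
Proof.
move=> tr L1 L2 XL1 XL2.
have [u1 [-> uu1 up1]] := isotropic_line_vector heta hp0 hp XL1.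
have [u2 [-> uu2 up2]] := isotropic_line_vector heta hp0 hp XL2.
have [h hu] := tr (screen_coord u1) (screen_coord u2).
exists (f h); first by exists h.
rewrite limg_line; have <- : lam h *: f h u1 = u2.
  apply: isotropic_screen_inj => //.
  - by rewrite linearZl_LR linearZr_LR /= f_eta uu1 !mulr0.
  - by rewrite linearZl_LR /= f_eta_p up1 mulr1 mulfV.
  - by rewrite screen_coordZ screen_f scalerA mulfV// scale1r up1 scale1r.
apply/eqP; rewrite eqEdim !dim_vline scaler_eq0 (negPf (lam0 h)) leqnn andbT.
by apply/vlineP; exists (lam h)^-1; rewrite scalerA mulVf// scale1r.
Qed.

End LineStabilizer.

(** * Regularity of matrix coefficients, and the equivalence *)

Lemma C1_immersion_entry (R : realType) (V : vectType R) (k : nat)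
    (H : groupTopologicalType) (atlas : set (chart R k H)) (f : H -> 'End(V)) i j :
  smooth_immersion atlas f -> C1_function atlas (fun h => matrix_of (f h) i j).
Proof.
move=> smf c ac w cw; have [sm _] := smf c ac.
pose F w := matrix_of (f (chart_inv c w)).
have dF w' : chart_img c w' -> differentiable F w'.
  by move=> cw'; apply: (sm 1%N).1; rewrite inE.
have dFij w' : chart_img c w' -> differentiable (fun w => F w i j) w'.
  move=> cw'; apply: (@differentiable_comp _ _ _ _ F (fun M : 'M[R]__ => M i j)).
    exact: dF.
  exact: differentiable_coord.
split; first exact: dFij.
move=> v; apply: (@near_eq_continuous _ _ (fun w' => 'D_v F w' i j)).
  apply: filterS (chart_img_near cw) => w' cw'.
  by rewrite derive_mx ?mxE//; exact/diff_derivable/dF.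
apply: (@continuous_comp _ _ _ ('D_v F) (fun M : 'M[R]__ => M i j)).
  by apply: ((sm 1%N).2 v); rewrite inE.
exact: coord_continuous.
Qed.

Lemma C1_immersion_form (R : realType) (V : vectType R) (eta : {symmetric V})
    (k : nat) (H : groupTopologicalType) (atlas : set (chart R k H))
    (f : H -> 'End(V)) (u v : V) :
  smooth_immersion atlas f -> C1_function atlas (fun h => eta (f h u) v).
Proof.
move=> smf; set e := vbasis {:V}.
have eb : basis_of {:V} e by exact: vbasisP.
have -> : (fun h => eta (f h u) v) = (fun h => \sum_j (\sum_i
    passmx.rVof e u 0 i * matrix_of (f h) i j) * eta e`_j v).
  apply/funext => h; rewrite -{1}(passmx.rVofK eb u) (passmx.hom_vecof _ eb).
  rewrite /passmx.vecof linear_sumlz; apply: eq_bigr => j _.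
  by rewrite linearZl_LR mxE.
apply: C1_sum => j; apply: C1_mul; last exact: C1_cst.
by apply: C1_sum => i; apply: C1_mul; [exact: C1_cst|exact: C1_immersion_entry].
Qed.

Theorem theorem4 (R : realType) (n : nat) (V : vectType R)
  (eta : {symmetric V}) (p : V) (G : set 'End(V))
  (hn : (1 <= n)%N)
  (hV : \dim {:V} = n.+2)
  (heta : has_signature eta 1 n.+1)
  (hp0 : p != 0)
  (hp : eta p p = 0)
  (hG : connected_lie_subgroup G)
  (hGproper : G `<` SO_line eta p) :
  weakly_irreducible eta G <->
  transitive_on_lines G (isotropic_lines eta `\ <[p]>%VS).
Proof.
have [k [H [atlas [f [lieH connH [f1 fM] [_ rfG] smf]]]]] := hG.
have fSO h : SO_line eta p (f h) by apply: hGproper.1; rewrite -rfG; exists h.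
rewrite -rfG; split=> [wi|]; last first.
  by apply: (transitive_weakly_irreducible heta) => //; rewrite hV.
have [q [m [s [qq pq sE ss wittE]]]] := witt_basis heta hp0 hp.
have sp i := (sE i).1; have sq i := (sE i).2.
apply: (affine_transitive_lines heta hp0 hp f1 fM fSO qq pq sp sq wittE).
have [e ae e1] := lie_atlas_cover lieH 1%g.
have C1lam : C1_function atlas (eigenvalue_at eta p f q) by exact: C1_immersion_form.
(* The squared ratio of the similarity given by [h] is the square of its eigenvalue on [p]. *)
apply: (@affine_action_transitive R k m H atlas lieH connH _ _
  (fun h => eigenvalue_at eta p f q h ^+ 2) _ _ _ _ _ _ _ e ae e1).
- move=> i j; have -> : (fun h => similarity_linear eta p f q s h i j) =
    (fun h => eigenvalue_at eta p f q h * eta (f h (s i)) (s j)).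
    by apply/funext => h; rewrite mxE.
  by apply: C1_mul => //; exact: C1_immersion_form.
- move=> j; have -> : (fun h => similarity_translation eta p f q s h 0 j) =
    (fun h => eigenvalue_at eta p f q h * eta (f h q) (s j)).
    by apply/funext => h; rewrite mxE.
  by apply: C1_mul => //; exact: C1_immersion_form.
- exact: similarity_act1.
- exact: similarity_actM.
- exact: similarity_linear_conformal.
- by move=> h; rewrite -exprMn (eigenvalue_atV f1 fM fSO pq) expr1n.
- exact: (affine_weakly_irreducible heta hp0 hp f1 fM fSO).
Qed.
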